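(* In $\mathbf{ZF}$, the following are equivalent: (i) $\mathbf{CAC_{fin}}$: every denumerable family of non-empty finite sets has a choice function; (ii) Dedekind-finiteness is equivalent to quasi Dedekind-finiteness (that is, every set is Dedekind-finite if and only if it is quasi Dedekind-finite); (iii) for every infinite set $X$, either $\mathbf{S}(X,[X]^{\leq\omega})$ is a $P$-space or $X$ is Dedekind-infinite; (iv) for every infinite Dedekind-finite set $X$, $\mathbf{S}(X,[X]^{\leq\omega})$ is a $P$-space; (v) $\mathbf{PS}_2$: for every infinite set $X$, there exists an infinite set $Y\subseteq X$ such that $\mathbf{S}(Y,[Y]^{\leq\omega})$ is a $P$-space.
   Context: The background theory is $\mathbf{ZF}$ (no axiom of choice). A set is denumerable if equipotent to $\omega$, countable if it injects into $\omega$. $[X]^{<\omega}$, $[X]^{\leq\omega}$ are the sets of finite, respectively countable, subsets of $X$. A set $X$ is Dedekind-infinite if there is an injection $\omega\to X$, Dedekind-finite otherwise; $X$ is quasi Dedekind-finite if $[X]^{<\omega}$ is Dedekind-finite. For an infinite set $X$, $\mathbf{S}(X,[X]^{\leq\omega})$ is the set $[X]^{<\omega}$ with the topology consisting of all $V\subseteq[X]^{<\omega}$ such that for every $x\in V$ there is $z\in[X]^{\leq\omega}$ with $x\cap z=\emptyset$ and $\{y\in[X]^{<\omega}:x\subseteq y\subseteq X\setminus z\}\subseteq V$. A $P$-space is a topological space in which every $G_\delta$-set (countable intersection of open sets) is open. *)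

(* Defs.v *)
(* "In ZF, phi holds" is read as: phi holds in every model of first-order ZF.
   Rocq's own types and predicates are not used as the sets of the theory: over
   the usual classical axioms of Rocq they satisfy the axiom of choice, which
   would make all the choice principles below provable.  For the same reason
   Separation and Replacement range over first-order formulas only, not over
   arbitrary Rocq predicates on the model. *)

Set Implicit Arguments.
Unset Strict Implicit.
Unset Printing Implicit Defensive.

Record set_structure : Type := SetStructure {
  carrier :> Type;
  mem : carrier -> carrier -> Prop
}.

Arguments mem {s}.

Declare Scope zf_scope.
Delimit Scope zf_scope with zf.
Open Scope zf_scope.

Notation "x '∈' A" := (mem x A) (at level 70, no associativity) : zf_scope.
Notation "x '∉' A" := (~ mem x A) (at level 70, no associativity) : zf_scope.

(** * First-order formulas of the language {∈, =}, with de Bruijn indices *)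

Inductive formula : Type :=
| FMem (i j : nat)
| FEq (i j : nat)
| FFalse
| FImp (p q : formula)
| FAnd (p q : formula)
| FOr (p q : formula)
| FAll (p : formula)
| FEx (p : formula).

Definition scons (T : Type) (a : T) (e : nat -> T) (n : nat) : T :=
  match n with O => a | S m => e m end.

Fixpoint sat (M : set_structure) (e : nat -> M) (p : formula) : Prop :=
  match p with
  | FMem i j => e i ∈ e j
  | FEq i j => e i = e j
  | FFalse => False
  | FImp q r => sat e q -> sat e r
  | FAnd q r => sat e q /\ sat e r
  | FOr q r => sat e q \/ sat e r
  | FAll q => forall a : M, sat (scons a e) q
  | FEx q => exists a : M, sat (scons a e) q
  end.

(** * Basic set-theoretic vocabulary

    The language has no function symbols, so [is_foo r a b] says "r is the set
    foo(a, b)".  Every quantifier below ranges over the elements of [M] (over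
    formulas and environments too in the two schemes), so each notion is the
    interpretation in [M] of a first-order formula. *)

Section Vocabulary.

Context {M : set_structure}.
Implicit Types a b c f n p r u v w x y z A B C E F G I T U V W X Y : M.

Definition subset A B : Prop := forall x, x ∈ A -> x ∈ B.

Definition disjoint A B : Prop := forall x, x ∈ A -> x ∉ B.

Definition is_empty A : Prop := forall x, x ∉ A.

Definition is_upair p a b : Prop := forall x, x ∈ p <-> x = a \/ x = b.

(* Kuratowski's {{a}, {a, b}} *)
Definition is_opair p a b : Prop :=
  forall x, x ∈ p <-> is_upair x a a \/ is_upair x a b.

Definition is_inter2 W U V : Prop := forall x, x ∈ W <-> x ∈ U /\ x ∈ V.

Definition is_union U A : Prop := forall x, x ∈ U <-> exists a, a ∈ A /\ x ∈ a.

Definition is_powerset U A : Prop := forall x, x ∈ U <-> subset x A.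

(* r = a ∪ {a} *)
Definition is_succ r a : Prop := forall x, x ∈ r <-> x ∈ a \/ x = a.

Definition inductive A : Prop :=
  (exists x, is_empty x /\ x ∈ A) /\
  (forall x, x ∈ A -> exists y, is_succ y x /\ y ∈ A).

Definition is_omega w : Prop :=
  inductive w /\ forall A, inductive A -> subset w A.

(** * Functions and cardinality *)

Definition maps f a b : Prop := exists p, is_opair p a b /\ p ∈ f.

Definition is_function f A B : Prop :=
  (forall p, p ∈ f -> exists a b, a ∈ A /\ b ∈ B /\ is_opair p a b) /\
  (forall a, a ∈ A -> exists! b, maps f a b).

Definition is_injection f A B : Prop :=
  is_function f A B /\
  (forall a a' b, maps f a b -> maps f a' b -> a = a').

Definition is_bijection f A B : Prop :=
  is_injection f A B /\ (forall b, b ∈ B -> exists a, maps f a b).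

Definition injects A B : Prop := exists f, is_injection f A B.

Definition equipotent A B : Prop := exists f, is_bijection f A B.

Definition finite X : Prop :=
  exists w n, is_omega w /\ n ∈ w /\ equipotent X n.

Definition infinite X : Prop := ~ finite X.

Definition denumerable X : Prop := exists w, is_omega w /\ equipotent X w.

Definition countable X : Prop := exists w, is_omega w /\ injects X w.

Definition Dedekind_infinite X : Prop := exists w, is_omega w /\ injects w X.

Definition Dedekind_finite X : Prop := ~ Dedekind_infinite X.

(* E = [X]^{<ω} *)
Definition is_finite_subsets E X : Prop :=
  forall x, x ∈ E <-> subset x X /\ finite x.

(* I = [X]^{≤ω} *)
Definition is_countable_subsets I X : Prop :=
  forall x, x ∈ I <-> subset x X /\ countable x.

Definition quasi_Dedekind_finite X : Prop :=
  exists E, is_finite_subsets E X /\ Dedekind_finite E.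

(** * Choice *)

Definition is_choice_function f A : Prop :=
  exists U, is_union U A /\ is_function f A U /\
    (forall a b, a ∈ A -> maps f a b -> b ∈ a).

(** * Topology: a space is a pair (E, T), T the set of its open sets *)

Definition is_topological_space E T : Prop :=
  (forall V, V ∈ T -> subset V E) /\
  E ∈ T /\
  (forall U V W, U ∈ T -> V ∈ T -> is_inter2 W U V -> W ∈ T) /\
  (forall C U, subset C T -> is_union U C -> U ∈ T).

(* G is the intersection, taken inside E, of a countable set of open sets *)
Definition is_Gdelta E T G : Prop :=
  exists C, countable C /\ subset C T /\
    (forall x, x ∈ G <-> x ∈ E /\ forall V, V ∈ C -> x ∈ V).

Definition is_P_space E T : Prop :=
  is_topological_space E T /\ (forall G, is_Gdelta E T G -> G ∈ T).

(* (E, T) = S(X, I) *)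
Definition is_S_space E T X I : Prop :=
  is_finite_subsets E X /\
  (forall V, V ∈ T <->
    subset V E /\
    (forall x, x ∈ V -> exists z, z ∈ I /\ disjoint x z /\
       (forall y, y ∈ E -> subset x y ->
          (forall u, u ∈ y -> u ∈ X /\ u ∉ z) -> y ∈ V))).

(* S(X, [X]^{≤ω}) is a P-space *)
Definition S_countable_is_P_space X : Prop :=
  exists I E T, is_countable_subsets I X /\ is_S_space E T X I /\
    is_P_space E T.

End Vocabulary.

(** * Zermelo-Fraenkel set theory, without choice *)

Record ZF (M : set_structure) : Prop := {
  ZF_extensionality :
    forall A B : M, (forall x : M, x ∈ A <-> x ∈ B) -> A = B;
  ZF_foundation :
    forall A : M, (exists x : M, x ∈ A) -> exists x : M, x ∈ A /\ disjoint x A;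
  ZF_pairing : forall a b : M, exists p : M, is_upair p a b;
  ZF_union : forall A : M, exists U : M, is_union U A;
  ZF_powerset : forall A : M, exists U : M, is_powerset U A;
  ZF_infinity : exists A : M, inductive A;
  ZF_separation :
    forall (p : formula) (e : nat -> M) (A : M),
    exists B : M, forall x : M, x ∈ B <-> x ∈ A /\ sat (scons x e) p;
  (* in [p], index 0 is the argument x, index 1 the value y *)
  ZF_replacement :
    forall (p : formula) (e : nat -> M) (A : M),
    (forall x y y' : M, x ∈ A ->
       sat (scons x (scons y e)) p -> sat (scons x (scons y' e)) p -> y = y') ->
    exists B : M, forall y : M,
      y ∈ B <-> exists x : M, x ∈ A /\ sat (scons x (scons y e)) p
}.

(** * The principles *)

Definition CAC_fin (M : set_structure) : Prop :=
  forall A : M, denumerable A ->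
    (forall a : M, a ∈ A -> ~ is_empty a /\ finite a) ->
    exists f : M, is_choice_function f A.

Definition PS2 (M : set_structure) : Prop :=
  forall X : M, infinite X ->
    exists Y : M, subset Y X /\ infinite Y /\ S_countable_is_P_space Y.

(* Main.v *)
(** Separation and Replacement are available for first-order formulas only, so
    every class and class function used below is shown definable with
    parameters; this is closed under the logical operations, definite
    description and substitution, hence provable by syntax-directed search.

    (i) => (ii): given an injection g from ω to [X]^{<ω}, choose for each n a
    point of g(m) outside g(0) ∪ ... ∪ g(n-1), with m least such that one exists.
    The resulting sequence in X takes each value finitely often.

    (ii) => (iii): let X be Dedekind-finite, V open and x in V.  Among the finite z
    witnessing this, those of least size are finitely many, so their union is a
    witness z_V depending definably on V.  For countably many V the sets z_V
    form a countable subset of the Dedekind-finite set [X]^{<ω}, hence a finite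
    one, and its union is a common witness.

    (iv) => (v): over a denumerable subset of X, the topology is discrete.

    (v) => (i): let X be the set of choice functions on finite initial segments of
    the family, tagged with their length, and Y an infinite subset as in (v).  The
    finite sets avoiding a given length form an open set, and {∅} is the
    intersection of these; it is therefore open, which forces Y to be countable.  An
    enumeration of Y then selects a long enough partial choice function for
    every member of the family. *)

From Stdlib Require Import Classical ClassicalEpsilon PeanoNat Lia.
Require Import Defs.

(** * First-order definability with parameters *)

Section Renaming.
Context {M : set_structure}.

Definition up (r : nat -> nat) (n : nat) : nat :=
  match n with O => O | S m => S (r m) end.

Fixpoint rename (r : nat -> nat) (p : formula) : formula :=
  match p with
  | FMem i j => FMem (r i) (r j)
  | FEq i j => FEq (r i) (r j)
  | FFalse => FFalse
  | FImp p q => FImp (rename r p) (rename r q)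
  | FAnd p q => FAnd (rename r p) (rename r q)
  | FOr p q => FOr (rename r p) (rename r q)
  | FAll p => FAll (rename (up r) p)
  | FEx p => FEx (rename (up r) p)
  end.

Lemma sat_rename p : forall (r : nat -> nat) (e e' : nat -> M),
  (forall n, e (r n) = e' n) -> (sat e (rename r p) <-> sat e' p).
Proof.
  induction p; intros r e e' H; simpl.
  1,2: now rewrite !H.
  - tauto.
  - now rewrite (IHp1 r e e' H), (IHp2 r e e' H).
  - now rewrite (IHp1 r e e' H), (IHp2 r e e' H).
  - now rewrite (IHp1 r e e' H), (IHp2 r e e' H).
  - assert (K : forall a, sat (scons a e) (rename (up r) p) <-> sat (scons a e') p)
      by (intro a; apply IHp; intros [|n]; simpl; auto).
    split; intros L a; apply K, L.
  - assert (K : forall a, sat (scons a e) (rename (up r) p) <-> sat (scons a e') p)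
      by (intro a; apply IHp; intros [|n]; simpl; auto).
    split; intros [a L]; exists a; apply K, L.
Qed.

Lemma sat_ext p (e e' : nat -> M) : (forall n, e n = e' n) -> (sat e p <-> sat e' p).
Proof.
  intro H. rewrite <- (sat_rename p (fun n => n) e e) by reflexivity.
  now apply sat_rename.
Qed.

(* Each variable of the formula is bound by [s] either to a variable of the
   environment or to a parameter, so [Def P] reads "P is first-order definable
   with parameters". *)
Definition valuation (s : nat -> nat + M) (e : nat -> M) (n : nat) : M :=
  match s n with inl i => e i | inr a => a end.

Definition Def (P : (nat -> M) -> Prop) : Prop :=
  exists p s, forall e, sat (valuation s e) p <-> P e.

Lemma Def_ext P Q : Def P -> (forall e, P e <-> Q e) -> Def Q.
Proof.
  intros (p & s & H) K. exists p, s. intro e. now rewrite H.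
Qed.

(** The two formulas come with different bindings [s] and [t]. Moving the variables of one to even
    and of the other to odd positions lets a single binding serve both. *)
Lemma Def_two P Q : Def P -> Def Q -> exists p q s,
  forall e, (sat (valuation s e) p <-> P e) /\ (sat (valuation s e) q <-> Q e).
Proof.
  intros (p & s & H) (q & t & K).
  exists (rename (fun n => 2 * n) p), (rename (fun n => 2 * n + 1) q),
    (fun n => if Nat.even n then s (Nat.div2 n) else t (Nat.div2 n)).
  intro e; rewrite <- H, <- K; split; apply sat_rename; intro n; unfold valuation.
  - now rewrite Nat.even_even, Nat.div2_double.
  - rewrite Nat.even_odd. replace (2 * n + 1) with (S (2 * n)) by lia.
    now rewrite Nat.div2_succ_double.
Qed.

Lemma Def_and P Q : Def P -> Def Q -> Def (fun e => P e /\ Q e).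
Proof.
  intros H K. destruct (Def_two _ _ H K) as (p & q & s & L).
  exists (FAnd p q), s. intro e; simpl. destruct (L e); tauto.
Qed.

Lemma Def_or P Q : Def P -> Def Q -> Def (fun e => P e \/ Q e).
Proof.
  intros H K. destruct (Def_two _ _ H K) as (p & q & s & L).
  exists (FOr p q), s. intro e; simpl. destruct (L e); tauto.
Qed.

Lemma Def_imp P Q : Def P -> Def Q -> Def (fun e => P e -> Q e).
Proof.
  intros H K. destruct (Def_two _ _ H K) as (p & q & s & L).
  exists (FImp p q), s. intro e; simpl. destruct (L e); tauto.
Qed.

(** By excluded middle [P] is equivalent to a formula that is always true or to one that is always
    false. A subformula that does not mention the environment is therefore definable, whatever its
    Rocq form. *)
Lemma Def_const (P : Prop) : Def (fun _ => P).
Proof.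
  destruct (classic P).
  - exists (FImp FFalse FFalse), inl. simpl; tauto.
  - exists FFalse, inl. simpl; tauto.
Qed.

Lemma Def_iff P Q : Def P -> Def Q -> Def (fun e => P e <-> Q e).
Proof. intros; unfold iff; apply Def_and; apply Def_imp; assumption. Qed.

(** Several formula variables may be bound by [s] to environment index 0. Quantifying over that
    index sends all of them to the new bound variable 0 and shifts the others by one;
    [bind_valuation] lowers the remaining environment indices to match. *)
Definition bind_index (s : nat -> nat + M) (n : nat) : nat :=
  match s n with inl O => O | _ => S n end.

Definition bind_valuation (s : nat -> nat + M) (n : nat) : nat + M :=
  match s n with inl i => inl (pred i) | inr a => inr a end.

Lemma bind_valuationE s e a n :
  scons a (valuation (bind_valuation s) e) (bind_index s n) =
  valuation s (scons a e) n.
Proof.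
  unfold bind_index, valuation, bind_valuation. destruct (s n) as [[|i]|b] eqn:E;
    simpl; try rewrite E; reflexivity.
Qed.

(** [Q] receives the bound variable as a separate argument so that the lemma unifies directly with a
    quantified goal; in the premise that variable becomes index 0. *)
Lemma Def_all (Q : M -> (nat -> M) -> Prop) :
  Def (fun e => Q (e 0) (fun n => e (S n))) -> Def (fun e => forall a, Q a e).
Proof.
  intros (p & s & H). exists (FAll (rename (bind_index s) p)), (bind_valuation s).
  intro e; simpl.
  assert (K : forall a,
      sat (scons a (valuation (bind_valuation s) e)) (rename (bind_index s) p) <-> Q a e).
  { intro a. rewrite (sat_rename p _ _ _ (bind_valuationE s e a)). apply H. }
  split; intros L a; apply K, L.
Qed.

Lemma Def_ex (Q : M -> (nat -> M) -> Prop) :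
  Def (fun e => Q (e 0) (fun n => e (S n))) -> Def (fun e => exists a, Q a e).
Proof.
  intros (p & s & H). exists (FEx (rename (bind_index s) p)), (bind_valuation s).
  intro e; simpl.
  assert (K : forall a,
      sat (scons a (valuation (bind_valuation s) e)) (rename (bind_index s) p) <-> Q a e).
  { intro a. rewrite (sat_rename p _ _ _ (bind_valuationE s e a)). apply H. }
  split; intros [a L]; exists a; apply K, L.
Qed.

Lemma Def_weaken P (r : nat -> nat) : Def P -> Def (fun e => P (fun n => e (r n))).
Proof.
  intros (p & s & H).
  exists p, (fun n => match s n with inl i => inl (r i) | inr a => inr a end).
  intro e. rewrite <- H. apply sat_ext. intro n; unfold valuation.
  destruct (s n); reflexivity.
Qed.

(** Definability of an operation is definability of its graph, with the value at index 0 and the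
    arguments shifted by one. *)
Definition DefT (t : (nat -> M) -> M) : Prop :=
  Def (fun e => e 0 = t (fun n => e (S n))).

(** The language has no terms, so a substitution is expressed by quantifying existentially over the
    value of [t]. *)
Lemma Def_subst (Q : M -> (nat -> M) -> Prop) t :
  DefT t -> Def (fun e => Q (e 0) (fun n => e (S n))) -> Def (fun e => Q (t e) e).
Proof.
  intros H K.
  apply (Def_ext (fun e => exists a, a = t e /\ Q a e)).
  - apply (Def_ex (fun a e => a = t e /\ Q a e)). apply Def_and; assumption.
  - intro e. split; [intros (a & -> & L); exact L | now exists (t e)].
Qed.

Lemma DefT_weaken t (r : nat -> nat) : DefT t -> DefT (fun e => t (fun n => e (r n))).
Proof. intro H. exact (Def_weaken _ (up r) H). Qed.

Lemma DefT_var i : DefT (fun e => e i).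
Proof.
  exists (FEq 0 (S i)), inl. intro e; reflexivity.
Qed.

Lemma DefT_const a : DefT (fun _ => a).
Proof.
  exists (FEq 0 1), (fun n => match n with O => inl O | _ => inr a end).
  intro e; reflexivity.
Qed.

Lemma Def_subst2 (R : M -> M -> Prop) t u :
  DefT t -> DefT u -> Def (fun e => R (e 0) (e 1)) -> Def (fun e => R (t e) (u e)).
Proof.
  intros H K L.
  apply (Def_subst (fun a e => R a (u e)) _ H).
  apply (Def_subst (fun b e => R (e 0) b) _ (DefT_weaken _ S K)).
  exact (Def_weaken _ (fun n => match n with O => 1 | _ => 0 end) L).
Qed.

Lemma Def_mem t u : DefT t -> DefT u -> Def (fun e => t e ∈ u e).
Proof.
  intros H K. apply Def_subst2; auto. now exists (FMem 0 1), inl.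
Qed.

Lemma Def_eq t u : DefT t -> DefT u -> Def (fun e => t e = u e).
Proof.
  intros H K. apply (Def_subst2 (fun a b => a = b)); auto. now exists (FEq 0 1), inl.
Qed.

Definition Def1 (P : M -> Prop) : Prop := Def (fun e => P (e 0)).
Definition DefF (F : M -> M) : Prop := DefT (fun e => F (e 0)).

Lemma Def1_app P t : Def1 P -> DefT t -> Def (fun e => P (t e)).
Proof.
  intros H K. apply (Def_subst (fun a e => P a) _ K). exact H.
Qed.

Lemma DefF_app F t : DefF F -> DefT t -> DefT (fun e => F (t e)).
Proof.
  intros H K. unfold DefT. apply (Def_subst (fun a e => e 0 = F a)
    (fun e => t (fun n => e (S n))) (DefT_weaken _ S K)).
  exact (Def_weaken _ (fun n => match n with O => 1 | S _ => 0 end) H).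
Qed.

Lemma DefT_app2 (F : M -> M -> M) : DefT (fun e => F (e 0) (e 1)) ->
  forall t u, DefT t -> DefT u -> DefT (fun e => F (t e) (u e)).
Proof.
  intros H t u K L.
  assert (K' := DefT_weaken _ S K). assert (L' := DefT_weaken _ S L).
  apply (Def_ext (fun e => exists a b,
    a = t (fun n => e (S n)) /\ b = u (fun n => e (S n)) /\ e 0 = F a b)).
  - apply (Def_ex (fun a e => exists b,
      a = t (fun n => e (S n)) /\ b = u (fun n => e (S n)) /\ e 0 = F a b)).
    apply (Def_ex (fun b e =>
      e 0 = t (fun n => e (S (S n))) /\ b = u (fun n => e (S (S n))) /\ e 1 = F (e 0) b)).
    repeat apply Def_and.
    + apply Def_eq; [apply DefT_var | exact (DefT_weaken _ (fun n => S (S (S n))) K)].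
    + apply Def_eq; [apply DefT_var | exact (DefT_weaken _ (fun n => S (S (S n))) L)].
    + exact (Def_weaken _ (fun n => match n with 0 => 2 | 1 => 1 | _ => 0 end) H).
  - intro e. split; [intros (a & b & -> & -> & E); exact E|]. intro E; eauto.
Qed.

End Renaming.

(** * Separation, replacement and definite description for definable classes *)

Section ZFModel.
Context {M : set_structure} (HZF : ZF M).

Lemma ZF_inhabited : inhabited M.
Proof. destruct (ZF_infinity HZF) as [A _]. exact (inhabits A). Qed.

Lemma ext (A B : M) : (forall x, x ∈ A <-> x ∈ B) -> A = B.
Proof. apply (ZF_extensionality HZF). Qed.

(** [Def1] looks at index 0 only, so the formula may be evaluated in the environment that is
    constantly x. Every formula variable that is not a parameter can then be renamed to 0, the place
    of x in the scheme. *)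
Lemma separation (P : M -> Prop) (A : M) :
  Def1 P -> exists B : M, forall x, x ∈ B <-> x ∈ A /\ P x.
Proof.
  intros (p & s & H).
  destruct (ZF_separation HZF
    (rename (fun n => match s n with inl _ => 0 | inr _ => S n end) p)
    (fun n => match s n with inl _ => A | inr a => a end) A) as [B K].
  exists B. intro x. rewrite K, <- (H (fun _ => x)).
  rewrite (sat_rename p _ _ (valuation s (fun _ => x))); [reflexivity|].
  intro n; unfold valuation. destruct (s n) eqn:E; simpl; [|rewrite E]; reflexivity.
Qed.

Lemma replacement (F : M -> M) (A : M) :
  DefF F -> exists B : M, forall y, y ∈ B <-> exists x, x ∈ A /\ y = F x.
Proof.
  intros (p & s & H).
  (* In [DefF] the value sits at index 0 and the argument fills all other indices, while the scheme
     has the argument at 0 and the value at 1; hence the exchange of 0 and 1. *)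
  set (r n := match s n with inl O => 1 | inl _ => 0 | inr _ => S (S n) end).
  set (e n := match s n with inl _ => A | inr a => a end).
  assert (K : forall x y, sat (scons x (scons y e)) (rename r p) <-> y = F x).
  { intros x y. rewrite (sat_rename p r _ (valuation s (scons y (fun _ => x)))).
    - apply H.
    - intro n; unfold r, e, valuation. destruct (s n) as [[|i]|a] eqn:E; simpl;
        [| |rewrite E]; reflexivity. }
  destruct (ZF_replacement HZF (p := rename r p) (e := e) (A := A)) as [B L].
  - intros x y y' _. rewrite 2!K. congruence.
  - exists B. intro y. rewrite L. now setoid_rewrite K.
Qed.

(** * Definable set operations *)

Lemma empty_exists : exists a : M, is_empty a.
Proof.
  destruct (ZF_infinity HZF) as [A [[x [H _]] _]]. now exists x.
Qed.

(* Definite description, with junk value the empty set, so that it is definable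
   without a uniqueness proof. *)
Definition the (P : M -> Prop) : M :=
  epsilon ZF_inhabited
    (fun y => (exists! x, P x) /\ P y \/ ~ (exists! x, P x) /\ is_empty y).

Lemma the_spec (P : M -> Prop) :
  (exists! x, P x) /\ P (the P) \/ ~ (exists! x, P x) /\ is_empty (the P).
Proof.
  unfold the. apply (epsilon_spec ZF_inhabited
    (fun y => (exists! x, P x) /\ P y \/ ~ (exists! x, P x) /\ is_empty y)).
  destruct (classic (exists! x, P x)) as [[x K]|K].
  - exists x. left. split; [now exists x | apply K].
  - destruct empty_exists as [a E]. exists a. now right.
Qed.

Lemma the_eq (P : M -> Prop) a : P a -> (forall b, P b -> b = a) -> the P = a.
Proof.
  intros H K. destruct (the_spec P) as [[_ L]|[L _]]; [now apply K|].
  destruct L. exists a. split; auto. intros b Hb. symmetry; auto.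
Qed.

Lemma the_prop (P : M -> Prop) a : P a -> (forall b, P b -> b = a) -> P (the P).
Proof. intros H K. now rewrite (the_eq P a H K). Qed.

(** The disjunction in [the_spec] determines the value in either case, by uniqueness or because
    there is only one empty set, so it defines the graph of [the]. *)
Lemma DefT_the (P : M -> (nat -> M) -> Prop) :
  Def (fun e => P (e 0) (fun n => e (S n))) -> DefT (fun e => the (fun x => P x e)).
Proof.
  intro H. unfold DefT.
  assert (U : Def (fun e => exists! x, P x (fun n => e (S n)))).
  { unfold unique. apply (Def_ex (fun x e => P x (fun n => e (S n)) /\
      forall x', P x' (fun n => e (S n)) -> x = x')).
    apply Def_and.
    - exact (Def_weaken _ (fun n => match n with O => 0 | S n => S (S n) end) H).
    - apply (Def_all (fun x e => P x (fun n => e (S (S n))) -> e 0 = x)).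
      apply Def_imp.
      + exact (Def_weaken _ (fun n => match n with O => 0 | S n => S (S (S n)) end) H).
      + apply Def_eq; apply DefT_var. }
  apply (Def_ext (fun e => (exists! x, P x (fun n => e (S n))) /\ P (e 0) (fun n => e (S n))
     \/ ~ (exists! x, P x (fun n => e (S n))) /\ forall z, z ∈ e 0 -> False)).
  - apply Def_or; apply Def_and; auto.
    + apply Def_imp; [auto|apply Def_const].
    + apply (Def_all (fun z e => z ∈ e 0 -> False)). apply Def_imp; [|apply Def_const].
      apply Def_mem; apply DefT_var.
  - intro e. set (Q := fun x => P x (fun n => e (S n))).
    change ((exists! x, Q x) /\ Q (e 0) \/ ~ (exists! x, Q x) /\ is_empty (e 0) <->
      e 0 = the Q).
    destruct (the_spec Q) as [[[x [L L']] K]|[L K]].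
    + split.
      * intros [[_ N]|[N _]]; [| destruct N; now exists x].
        now rewrite <- (L' _ K), <- (L' _ N).
      * intros ->. left. split; auto. exists x; split; auto.
    + split.
      * intros [[N _]|[_ N]]; [contradiction|]. apply ext. intro z.
        split; intro Z; [destruct (N z Z)|destruct (K z Z)].
      * intros ->. now right.
Qed.


(** [sep] and [repl] accept arbitrary Rocq predicates and functions; where no set with the required
    members exists they take the junk value of [the]. Their membership lemmas therefore assume
    definability. *)
Definition sep (A : M) (P : M -> Prop) : M :=
  the (fun B => forall x, x ∈ B <-> x ∈ A /\ P x).
Definition repl (A : M) (F : M -> M) : M :=
  the (fun B => forall y, y ∈ B <-> exists x, x ∈ A /\ y = F x).
Definition pow (A : M) : M := the (fun U => is_powerset U A).
Definition Un (A : M) : M := the (fun U => is_union U A).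
Definition upair (a b : M) : M := the (fun p => is_upair p a b).
Definition empty : M := the is_empty.
Definition cup (a b : M) : M := Un (upair a b).
Definition add (x a : M) : M := cup a (upair x x).
Definition succ (n : M) : M := add n n.
Definition opair (a b : M) : M := upair (upair a a) (upair a b).
Definition diff (a b : M) : M := sep a (fun x => ~ x ∈ b).
Definition ite (P : Prop) (a b : M) : M := the (fun y => P /\ y = a \/ ~ P /\ y = b).
Definition app (f a : M) : M := the (fun b => opair a b ∈ f).
Definition second (p : M) : M := the (fun b => exists a, p = opair a b).
Definition lam (A : M) (F : M -> M) : M := repl A (fun x => opair x (F x)).
Definition om : M := the is_omega.

Lemma DefT_sep A (P : M -> (nat -> M) -> Prop) :
  DefT A -> Def (fun e => P (e 0) (fun n => e (S n))) ->
  DefT (fun e => sep (A e) (fun x => P x e)).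
Proof.
  intros H K. unfold sep.
  apply (DefT_the (fun B e => forall x, x ∈ B <-> x ∈ A e /\ P x e)).
  apply (Def_all (fun x e => x ∈ e 0 <-> x ∈ A (fun n => e (S n)) /\ P x (fun n => e (S n)))).
  apply Def_iff; [|apply Def_and].
  - apply Def_mem; apply DefT_var.
  - apply Def_mem; [apply DefT_var|].
    exact (DefT_weaken _ (fun n => S (S n)) H).
  - exact (Def_weaken _ (fun n => match n with O => 0 | S n => S (S n) end) K).
Qed.

Lemma DefT_repl A (F : M -> (nat -> M) -> M) :
  DefT A -> DefT (fun e => F (e 0) (fun n => e (S n))) ->
  DefT (fun e => repl (A e) (fun x => F x e)).
Proof.
  intros H K. unfold repl.
  apply (DefT_the (fun B e => forall y, y ∈ B <-> exists x, x ∈ A e /\ y = F x e)).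
  apply (Def_all (fun y e => y ∈ e 0 <-> exists x, x ∈ A (fun n => e (S n)) /\
    y = F x (fun n => e (S n)))).
  apply Def_iff; [apply Def_mem; apply DefT_var|].
  apply (Def_ex (fun x e => x ∈ A (fun n => e (S (S n))) /\
    e 0 = F x (fun n => e (S (S n))))).
  apply Def_and.
  - apply Def_mem; [apply DefT_var|].
    exact (DefT_weaken _ (fun n => S (S (S n))) H).
  - apply Def_eq; [apply DefT_var|].
    exact (DefT_weaken _ (fun n => match n with O => 0 | S n => S (S (S n)) end) K).
Qed.

(** * Automated definability proofs *)

Ltac def_atom := fail.
Ltac def_unfold :=
  progress unfold Def1, DefF, subset, disjoint, is_empty, is_upair, is_union, is_powerset,
    is_succ, inductive, is_omega, is_opair, maps, unique, not, is_function, is_injection,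
    is_bijection, injects, equipotent, finite, countable, upair, pow, Un, cup, add, diff,
    opair, app, second.
Ltac def_step :=
  cbv beta;
  first
  [ assumption
  | match goal with
    | H : DefF ?F |- DefT (fun e => ?F (@?t e)) => apply (DefF_app F t H)
    | H : Def1 ?P |- Def (fun e => ?P (@?t e)) => apply (Def1_app P t H)
    end
  | simple apply DefT_var
  | simple apply DefT_const
  | simple apply Def_const
  | simple apply Def_mem
  | simple apply Def_eq
  | simple apply Def_and
  | simple apply Def_or
  | simple apply Def_iff
  | simple apply Def_imp
  | def_atom
  | simple apply Def_all
  | simple apply Def_ex
  | simple apply DefT_sep
  | simple apply DefT_repl
  | def_unfold
  | simple apply DefT_the ].
Ltac def := solve [repeat def_step].

Lemma DefT_pow t : DefT t -> DefT (fun e => pow (t e)).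
Proof. apply (DefF_app pow). def. Qed.

Lemma DefT_Un t : DefT t -> DefT (fun e => Un (t e)).
Proof. apply (DefF_app Un). def. Qed.

Lemma DefT_second t : DefT t -> DefT (fun e => second (t e)).
Proof. apply (DefF_app second). def. Qed.

Lemma DefT_upair t u : DefT t -> DefT u -> DefT (fun e => upair (t e) (u e)).
Proof. apply (DefT_app2 upair). def. Qed.

Lemma DefT_opair t u : DefT t -> DefT u -> DefT (fun e => opair (t e) (u e)).
Proof. apply (DefT_app2 opair). def. Qed.

Lemma DefT_cup t u : DefT t -> DefT u -> DefT (fun e => cup (t e) (u e)).
Proof. apply (DefT_app2 cup). def. Qed.

Lemma DefT_add t u : DefT t -> DefT u -> DefT (fun e => add (t e) (u e)).
Proof. apply (DefT_app2 add). def. Qed.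

Lemma DefT_diff t u : DefT t -> DefT u -> DefT (fun e => diff (t e) (u e)).
Proof. apply (DefT_app2 diff). def. Qed.

Lemma DefT_app t u : DefT t -> DefT u -> DefT (fun e => app (t e) (u e)).
Proof. apply (DefT_app2 app). def. Qed.

Lemma DefT_ite P t u : Def P -> DefT t -> DefT u -> DefT (fun e => ite (P e) (t e) (u e)).
Proof.
  intros H K L.
  apply (DefT_the (fun y e => P e /\ y = t e \/ ~ P e /\ y = u e)).
  assert (H' := Def_weaken _ S H). assert (K' := DefT_weaken _ S K).
  assert (L' := DefT_weaken _ S L). def.
Qed.

Lemma Def_finite (t : (nat -> M) -> M) : DefT t -> Def (fun e => finite (t e)).
Proof. apply (Def1_app (@finite M)). def. Qed.

Lemma Def_countable (t : (nat -> M) -> M) : DefT t -> Def (fun e => countable (t e)).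
Proof. apply (Def1_app (@countable M)). def. Qed.

Lemma Def_injects (t u : (nat -> M) -> M) :
  DefT t -> DefT u -> Def (fun e => injects (t e) (u e)).
Proof. intros H K. apply (Def_subst2 (@injects M)); auto. def. Qed.

Lemma Def_equipotent (t u : (nat -> M) -> M) :
  DefT t -> DefT u -> Def (fun e => equipotent (t e) (u e)).
Proof. intros H K. apply (Def_subst2 (@equipotent M)); auto. def. Qed.

Lemma Def_subset (t u : (nat -> M) -> M) :
  DefT t -> DefT u -> Def (fun e => subset (t e) (u e)).
Proof. intros H K. apply (Def_subst2 (@subset M)); auto. def. Qed.

(** With closure lemmas at hand, the search now treats these notions as atoms; up to this point it
    unfolded them down to membership, equality and [the]. *)
Ltac def_atom ::= first
  [ simple apply DefT_pow
  | simple apply DefT_Un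
  | simple apply DefT_second
  | simple apply DefT_upair
  | simple apply DefT_opair
  | simple apply DefT_cup
  | simple apply DefT_add
  | simple apply DefT_diff
  | simple apply DefT_app
  | simple apply DefT_ite
  | simple apply Def_finite
  | simple apply Def_countable
  | simple apply Def_injects
  | simple apply Def_equipotent
  | simple apply Def_subset ].
Ltac def_unfold ::=
  progress unfold Def1, DefF, infinite, disjoint, is_empty, unique, not, succ, lam.

Implicit Types a b c d f g k m n p x y z u w A B C E I S T U V W X Y : M.

(** * Membership in the set operations, and the relational vocabulary in terms of them *)

Lemma mem_sep A (P : M -> Prop) : Def1 P -> forall x, x ∈ sep A P <-> x ∈ A /\ P x.
Proof.
  intro H. destruct (separation P A H) as [B K].
  apply (the_prop (fun B => forall x, x ∈ B <-> x ∈ A /\ P x) B K).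
  intros C L. apply ext. intro x. now rewrite L, K.
Qed.

Lemma mem_repl A (F : M -> M) :
  DefF F -> forall y, y ∈ repl A F <-> exists x, x ∈ A /\ y = F x.
Proof.
  intro H. destruct (replacement F A H) as [B K].
  apply (the_prop (fun B => forall y, y ∈ B <-> exists x, x ∈ A /\ y = F x) B K).
  intros C L. apply ext. intro x. now rewrite L, K.
Qed.

Lemma mem_pow A x : x ∈ pow A <-> subset x A.
Proof.
  destruct (ZF_powerset HZF A) as [U K].
  apply (the_prop (fun U => is_powerset U A) U K).
  intros C L. apply ext. intro z. now rewrite (L z), (K z).
Qed.

Lemma mem_Un A x : x ∈ Un A <-> exists a, a ∈ A /\ x ∈ a.
Proof.
  destruct (ZF_union HZF A) as [U K].
  apply (the_prop (fun U => is_union U A) U K).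
  intros C L. apply ext. intro z. now rewrite (L z), (K z).
Qed.

Lemma mem_upair a b x : x ∈ upair a b <-> x = a \/ x = b.
Proof.
  destruct (ZF_pairing HZF a b) as [U K].
  apply (the_prop (fun U => is_upair U a b) U K).
  intros C L. apply ext. intro z. now rewrite (L z), (K z).
Qed.

Lemma empty_unique a : is_empty a -> a = empty.
Proof.
  assert (U : forall a b : M, is_empty a -> is_empty b -> b = a).
  { intros c b H K. apply ext. intro x. split; intro L; [destruct (K x L)|destruct (H x L)]. }
  intro H. symmetry. apply the_eq; auto.
Qed.

Lemma not_mem_empty x : ~ x ∈ empty.
Proof. destruct empty_exists as [a H]. rewrite <- (empty_unique a H). apply H. Qed.

Lemma nonempty_mem a : ~ is_empty a -> exists x, x ∈ a.
Proof.
  intro H. apply NNPP. intro K. apply H. intros x L. apply K. now exists x.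
Qed.

Lemma mem_cup a b x : x ∈ cup a b <-> x ∈ a \/ x ∈ b.
Proof.
  unfold cup. rewrite mem_Un. setoid_rewrite mem_upair. split.
  - intros (c & [-> | ->] & L); auto.
  - intros [L|L]; eauto.
Qed.

Lemma mem_add x a y : y ∈ add x a <-> y ∈ a \/ y = x.
Proof. unfold add. rewrite mem_cup, mem_upair. tauto. Qed.

Lemma mem_diff a b x : x ∈ diff a b <-> x ∈ a /\ ~ x ∈ b.
Proof. unfold diff. rewrite mem_sep; [reflexivity|def]. Qed.

Lemma ite_true (P : Prop) a b : P -> ite P a b = a.
Proof. intro H. apply the_eq; [tauto|]. intros c [K|K]; tauto. Qed.

Lemma ite_false (P : Prop) a b : ~ P -> ite P a b = b.
Proof. intro H. apply the_eq; [tauto|]. intros c [K|K]; tauto. Qed.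

Lemma is_upairE p a b : is_upair p a b <-> p = upair a b.
Proof.
  split.
  - intro H. apply ext. intro x. now rewrite (H x), mem_upair.
  - intros -> x. apply mem_upair.
Qed.

Lemma is_opairE p a b : is_opair p a b <-> p = opair a b.
Proof.
  split.
  - intro H. apply ext. intro x. unfold opair. now rewrite (H x), mem_upair, 2!is_upairE.
  - intros -> x. unfold opair. now rewrite mem_upair, 2!is_upairE.
Qed.

Lemma upair_inj a b c d : upair a b = upair c d -> a = c /\ b = d \/ a = d /\ b = c.
Proof.
  intro H.
  assert (K : forall x, (x = a \/ x = b) <-> (x = c \/ x = d))
    by (intro x; rewrite <- 2!mem_upair, H; reflexivity).
  destruct (proj1 (K a) (or_introl eq_refl)), (proj1 (K b) (or_intror eq_refl)),
    (proj2 (K c) (or_introl eq_refl)), (proj2 (K d) (or_intror eq_refl));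
    subst; auto.
Qed.

Lemma opair_inj a b c d : opair a b = opair c d -> a = c /\ b = d.
Proof.
  intro H. destruct (upair_inj _ _ _ _ H) as [[K L]|[K L]];
    destruct (upair_inj _ _ _ _ K) as [[? ?]|[? ?]];
    destruct (upair_inj _ _ _ _ L) as [[? ?]|[? ?]]; subst; auto.
Qed.

(** * Functions and equipotence through definable operations *)

Lemma mapsE f a b : maps f a b <-> opair a b ∈ f.
Proof.
  split.
  - intros (p & H & K). apply is_opairE in H. now subst.
  - intro H. exists (opair a b). split; auto. now apply is_opairE.
Qed.

Lemma second_opair a b : second (opair a b) = b.
Proof.
  apply the_eq; [now exists a|]. intros c [d H]. symmetry. now apply (opair_inj a b d c).
Qed.

Lemma is_function_app f A B : is_function f A B ->
  forall a b, maps f a b <-> a ∈ A /\ b = app f a.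
Proof.
  intros [H K] a b.
  assert (L : forall a, a ∈ A -> forall b, maps f a b <-> b = app f a).
  { intros c C. destruct (K c C) as [d [D U]].
    assert (E : app f c = d).
    { apply the_eq; [now apply mapsE|]. intros d' D'. symmetry. apply U. now apply mapsE. }
    intro d'. rewrite E. split; [intro D'; symmetry; auto | now intros ->]. }
  split.
  - intro N. assert (a ∈ A).
    { destruct N as (p & P & Q). destruct (H p Q) as (a' & b' & A' & B' & P').
      apply is_opairE in P, P'. subst p. apply opair_inj in P'. destruct P'; now subst. }
    split; auto. now apply L.
  - intros [N ->]. now apply L.
Qed.

Lemma is_function_into f A B : is_function f A B -> forall a, a ∈ A -> app f a ∈ B.
Proof.
  intros H a K. assert (L : maps f a (app f a)) by now apply (is_function_app f A B H).
  destruct L as (p & P & Q). destruct (proj1 H p Q) as (a' & b' & A' & B' & P').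
  apply is_opairE in P, P'. subst p. apply opair_inj in P'. destruct P' as [_ P'].
  now rewrite P'.
Qed.

Definition into (F : M -> M) A B : Prop := forall a, a ∈ A -> F a ∈ B.
Definition inj_on (F : M -> M) A : Prop :=
  forall a a', a ∈ A -> a' ∈ A -> F a = F a' -> a = a'.

Lemma maps_lam A F : DefF F -> forall a b, maps (lam A F) a b <-> a ∈ A /\ b = F a.
Proof.
  intros H a b. rewrite mapsE. unfold lam. rewrite mem_repl by def. split.
  - intros (x & K & L). apply opair_inj in L as [-> ->]. auto.
  - intros [K ->]. eauto.
Qed.

Lemma lam_function A B F : DefF F -> into F A B -> is_function (lam A F) A B.
Proof.
  intros H K. split.
  - intros p P. unfold lam in P. rewrite mem_repl in P by def.
    destruct P as (x & X & ->). exists x, (F x). split; auto. split; auto.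
    now apply is_opairE.
  - intros a L. exists (F a). split; [now apply maps_lam|].
    intros b N. now apply maps_lam in N.
Qed.

(** A set function f yields the definable operation [app f], and a definable [F] restricts to the
    set function [lam A F] by replacement. Injections and bijections can thus be handled as Rocq
    functions whose definability is tracked separately. *)
Lemma injectsP A B :
  injects A B <-> exists F, DefF F /\ into F A B /\ inj_on F A.
Proof.
  split.
  - intros (f & H & K). exists (app f). split; [def|]. split.
    + exact (is_function_into f A B H).
    + intros a a' L N E. apply (K a a' (app f a)); apply (is_function_app f A B H); auto.
  - intros (F & H & K & L). exists (lam A F). split; [now apply lam_function|].
    intros a a' b P Q. apply maps_lam in P, Q; auto. destruct P as [P ->], Q as [Q E].
    now apply L.
Qed.

Lemma equipotentP A B : equipotent A B <->
  exists F, DefF F /\ into F A B /\ inj_on F A /\ (forall b, b ∈ B -> exists a, a ∈ A /\ b = F a).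
Proof.
  split.
  - intros (f & (H & K) & S). exists (app f). split; [def|]. repeat split.
    + exact (is_function_into f A B H).
    + intros a a' L N E. apply (K a a' (app f a)); apply (is_function_app f A B H); auto.
    + intros b L. destruct (S b L) as [a P]. exists a.
      now apply (is_function_app f A B H) in P.
  - intros (F & H & K & L & S). exists (lam A F). split; [split|].
    + now apply lam_function.
    + intros a a' b P Q. apply maps_lam in P, Q; auto. destruct P as [P ->], Q as [Q E].
      now apply L.
    + intros b B'. destruct (S b B') as (a & P & Q). exists a. apply maps_lam; auto.
Qed.

Lemma equipotent_injects A B : equipotent A B -> injects A B.
Proof. intros (f & H & _). now exists f. Qed.

Lemma equipotent_refl A : equipotent A A.
Proof.
  apply equipotentP. exists (fun x => x). split; [def|]. unfold into, inj_on. eauto 6.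
Qed.

(** Injectivity makes preimages unique, so the inverse is given by definite description. *)
Lemma equipotent_sym A B : equipotent A B -> equipotent B A.
Proof.
  rewrite 2!equipotentP. intros (F & H & K & L & S).
  assert (I : forall a, a ∈ A -> the (fun x => x ∈ A /\ F x = F a) = a).
  { intros a N. apply the_eq; auto. intros b [P Q]. now apply L. }
  exists (fun y => the (fun x => x ∈ A /\ F x = y)). split; [def|]. repeat split.
  - intros b N. destruct (S b N) as (a & P & ->). now rewrite I.
  - intros b b' N N' E. destruct (S b N) as (a & P & ->), (S b' N') as (a' & P' & ->).
    rewrite 2!I in E by auto. now subst.
  - intros a N. exists (F a). split; auto. now rewrite I.
Qed.

Lemma equipotent_trans A B C : equipotent A B -> equipotent B C -> equipotent A C.
Proof.
  rewrite 3!equipotentP. intros (F & H & K & L & S) (G & H' & K' & L' & S').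
  exists (fun x => G (F x)). split; [def|]. repeat split.
  - intros a N. auto.
  - intros a a' N N' E. apply L; auto.
  - intros c N. destruct (S' c N) as (b & P & ->). destruct (S b P) as (a & Q & ->).
    now exists a.
Qed.

Lemma injects_trans A B C : injects A B -> injects B C -> injects A C.
Proof.
  rewrite 3!injectsP. intros (F & H & K & L) (G & H' & K' & L').
  exists (fun x => G (F x)). split; [def|]. split.
  - intros a N. auto.
  - intros a a' N N' E. apply L; auto.
Qed.

Lemma subset_injects A B : subset A B -> injects A B.
Proof.
  intro H. apply injectsP. exists (fun x => x). split; [def|]. split; [exact H|].
  intros a a' _ _ E. exact E.
Qed.

Lemma equipotent_add A B x y :
  x ∉ A -> y ∉ B -> equipotent A B -> equipotent (add x A) (add y B).
Proof.
  rewrite 2!equipotentP. intros X Y (F & H & K & L & S).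
  set (G := fun z => ite (z ∈ A) (F z) y).
  assert (G1 : forall z, z ∈ A -> G z = F z) by (intros; now apply ite_true).
  assert (G2 : G x = y) by (now apply ite_false).
  exists G. split; [unfold G; def|]. repeat split.
  - intros a N. apply mem_add in N as [N| ->]; apply mem_add; [left|right]; auto.
    rewrite G1; auto.
  - intros a a' N N' E.
    apply mem_add in N as [N| ->], N' as [N'| ->]; rewrite ?G2, ?G1 in E by auto; auto.
    + destruct Y. rewrite <- E. auto.
    + destruct Y. rewrite E. auto.
  - intros b N. apply mem_add in N as [N| ->].
    + destruct (S b N) as (a & P & ->). exists a. rewrite G1, mem_add; auto.
    + exists x. rewrite mem_add; auto.
Qed.

(** * Natural numbers *)

Lemma is_succE r a : is_succ r a <-> r = succ a.
Proof.
  split.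
  - intro H. apply ext. intro x. unfold succ. now rewrite (H x), mem_add.
  - intros -> x. exact (mem_add a a x).
Qed.

Lemma inductiveE A : inductive A <-> empty ∈ A /\ forall x, x ∈ A -> succ x ∈ A.
Proof.
  split; intros [H K]; split.
  - destruct H as (x & X & L). now rewrite <- (empty_unique x X).
  - intros x X. destruct (K x X) as (y & Y & L). apply is_succE in Y. now subst.
  - exists empty. split; auto. intro. apply not_mem_empty.
  - intros x X. exists (succ x). split; auto. now apply is_succE.
Qed.

Lemma om_omega : is_omega om.
Proof.
  destruct (ZF_infinity HZF) as [A HA].
  assert (U : forall w w' : M, is_omega w -> is_omega w' -> w' = w).
  { intros w w' [H K] [H' K']. apply ext. intro x. split; [apply K'|apply K]; auto. }
  assert (D : Def1 (fun x => forall B, empty ∈ B /\ (forall x, x ∈ B -> succ x ∈ B) -> x ∈ B))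
    by def.
  (* ω is cut out of some inductive set [A] as the set of those elements that lie in every inductive
     set. *)
  set (w := sep A (fun x => forall B, empty ∈ B /\ (forall x, x ∈ B -> succ x ∈ B) -> x ∈ B)).
  assert (W : is_omega w).
  { split.
    - apply inductiveE in HA as [HA HA']. apply inductiveE. unfold w. split.
      + apply mem_sep; auto. split; auto. tauto.
      + intros x X. apply mem_sep in X as [X K]; auto. apply mem_sep; auto.
        split; auto. intros B [P Q]. apply Q, K. auto.
    - intros B HB x X. apply mem_sep in X as [X K]; auto. apply K. now apply inductiveE. }
  unfold om. apply (the_prop is_omega w); auto.
Qed.

Lemma is_omegaE w : is_omega w <-> w = om.
Proof.
  split; [|intros ->; apply om_omega].
  intros [H K]. destruct om_omega as [H' K']. apply ext. intro x.
  split; [apply K|apply K']; auto.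
Qed.

Lemma om_empty : empty ∈ om.
Proof. apply inductiveE, om_omega. Qed.

Lemma om_succ n : n ∈ om -> succ n ∈ om.
Proof. apply inductiveE, om_omega. Qed.

(** Minimality of ω is applied to the subset of ω separated by [P], which is why induction holds for
    definable predicates only. *)
Lemma om_ind (P : M -> Prop) : Def1 P -> P empty ->
  (forall n, n ∈ om -> P n -> P (succ n)) -> forall n, n ∈ om -> P n.
Proof.
  intros H K L n N.
  apply (mem_sep om P H). apply (proj2 om_omega); auto.
  apply inductiveE. split.
  - apply mem_sep; auto using om_empty.
  - intros x X. apply mem_sep in X as [X X']; auto. apply mem_sep; auto using om_succ.
Qed.

Lemma mem_succ n m : m ∈ succ n <-> m ∈ n \/ m = n.
Proof. exact (mem_add n n m). Qed.

Lemma om_trans n m : n ∈ om -> m ∈ n -> m ∈ om.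
Proof.
  intro H. revert n H m. apply (om_ind (fun n => forall m, m ∈ n -> m ∈ om)); [def| |].
  - intros m K. destruct (not_mem_empty m K).
  - intros n H K m L. apply mem_succ in L as [L| ->]; auto.
Qed.

Lemma om_mem_trans n m k : n ∈ om -> m ∈ n -> k ∈ m -> k ∈ n.
Proof.
  intro H. revert n H m k.
  apply (om_ind (fun n => forall m k, m ∈ n -> k ∈ m -> k ∈ n)); [def| |].
  - intros m k K. destruct (not_mem_empty m K).
  - intros n H K m k L N. apply mem_succ. apply mem_succ in L as [L| ->]; eauto.
Qed.

Lemma om_irrefl n : n ∈ om -> ~ n ∈ n.
Proof.
  revert n. apply (om_ind (fun n => ~ n ∈ n)); [def|apply not_mem_empty|].
  intros n H K L. apply mem_succ in L as [L|L].
  - apply K. apply (om_mem_trans n (succ n)); auto. apply mem_succ; auto.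
  - apply K. rewrite <- L at 2. apply mem_succ; auto.
Qed.

Lemma om_succ_mem n m : n ∈ om -> m ∈ n -> succ m ∈ n \/ succ m = n.
Proof.
  intro H. revert n H m.
  apply (om_ind (fun n => forall m, m ∈ n -> succ m ∈ n \/ succ m = n)); [def| |].
  - intros m K. destruct (not_mem_empty m K).
  - intros n H K m L. apply mem_succ in L as [L| ->]; auto.
    left. apply mem_succ. destruct (K m L); auto.
Qed.

Lemma om_total n m : n ∈ om -> m ∈ om -> m ∈ n \/ m = n \/ n ∈ m.
Proof.
  intros H K. revert n H m K.
  apply (om_ind (fun n => forall m, m ∈ om -> m ∈ n \/ m = n \/ n ∈ m)); [def| |].
  - apply om_ind; [def|auto|]. intros m H [K|[K|K]]; [destruct (not_mem_empty _ K)| |];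
      right; right; apply mem_succ; auto.
  - intros n H K m L. rewrite mem_succ. destruct (K m L) as [N|[N|N]]; auto.
    destruct (om_succ_mem m n L N); auto.
Qed.

(** Foundation, applied to the set of solutions in ω, gives a solution none of whose elements is a
    solution. *)
Lemma om_least (P : M -> Prop) : Def1 P -> (exists n, n ∈ om /\ P n) ->
  exists n, n ∈ om /\ P n /\ forall m, m ∈ n -> ~ P m.
Proof.
  intros H (n & K & L). destruct (ZF_foundation HZF (A := sep om P)) as (k & N & D).
  - exists n. now apply mem_sep.
  - apply mem_sep in N as [N N']; auto. exists k. repeat split; auto.
    intros m Q R. apply (D m Q). apply mem_sep; auto. split; auto. now apply (om_trans k).
Qed.

Definition mu (P : M -> Prop) : M :=
  the (fun n => n ∈ om /\ P n /\ forall m, m ∈ n -> ~ P m).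

Lemma mu_spec (P : M -> Prop) : Def1 P -> (exists n, n ∈ om /\ P n) ->
  mu P ∈ om /\ P (mu P) /\ forall m, m ∈ mu P -> ~ P m.
Proof.
  intros H K. destruct (om_least P H K) as [n N].
  apply (the_prop (fun n => n ∈ om /\ P n /\ forall m, m ∈ n -> ~ P m) n N).
  intros b (B & B' & B''). destruct N as (N & N' & N'').
  destruct (om_total n b N B) as [L|[L|L]]; auto.
  - destruct (N'' b); auto.
  - destruct (B'' n); auto.
Qed.

(** * Finite and countable sets *)

Lemma finiteE X : finite X <-> exists n, n ∈ om /\ equipotent X n.
Proof.
  split.
  - intros (w & n & W & H). apply is_omegaE in W. subst. now exists n.
  - intros (n & H). exists om, n. split; auto using om_omega.
Qed.

Lemma countableE X : countable X <-> injects X om.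
Proof.
  split.
  - intros (w & W & H). apply is_omegaE in W. now subst.
  - intro H. exists om. auto using om_omega.
Qed.

Lemma denumerableE X : denumerable X <-> equipotent X om.
Proof.
  split.
  - intros (w & W & H). apply is_omegaE in W. now subst.
  - intro H. exists om. auto using om_omega.
Qed.

Lemma Dedekind_infiniteE X : Dedekind_infinite X <-> injects om X.
Proof.
  split.
  - intros (w & W & H). apply is_omegaE in W. now subst.
  - intro H. exists om. auto using om_omega.
Qed.

Definition del x a : M := diff a (upair x x).

Lemma mem_del x a y : y ∈ del x a <-> y ∈ a /\ y <> x.
Proof. unfold del. rewrite mem_diff, mem_upair. tauto. Qed.

Lemma add_del x a : x ∈ a -> add x (del x a) = a.
Proof.
  intro H. apply ext. intro y. rewrite mem_add, mem_del.
  destruct (classic (y = x)) as [->|]; tauto.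
Qed.

Lemma finite_nat n : n ∈ om -> finite n.
Proof. intro H. apply finiteE. exists n. auto using equipotent_refl. Qed.

Lemma finite_equipotent A B : equipotent A B -> finite B -> finite A.
Proof.
  rewrite 2!finiteE. intros H (n & N & K). eauto using equipotent_trans.
Qed.

Lemma finite_empty : finite empty.
Proof. auto using finite_nat, om_empty. Qed.

Lemma finite_add x a : finite a -> finite (add x a).
Proof.
  intro H. destruct (classic (x ∈ a)) as [X|X].
  - replace (add x a) with a; auto. apply ext. intro y. rewrite mem_add.
    split; auto. intros [Y| ->]; auto.
  - rewrite finiteE in *. destruct H as (n & N & K).
    exists (succ n). split; auto using om_succ.
    exact (equipotent_add a n x n X (om_irrefl n N) K).
Qed.

(** Induction on the number of elements: given a bijection of a with [succ n], the point sent to n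
    is removed. *)
Lemma finite_ind (P : M -> Prop) : Def1 P -> P empty ->
  (forall a x, finite a -> P a -> x ∉ a -> P (add x a)) -> forall a, finite a -> P a.
Proof.
  intros D H K a Fa. apply finiteE in Fa as (n & N & E). revert n N a E.
  apply (om_ind (fun n => forall a, equipotent a n -> P a)); [def| |].
  - intros a E. replace a with empty; auto. symmetry. apply empty_unique.
    intros x X. apply equipotentP in E as (F & _ & F' & _).
    destruct (not_mem_empty (F x)); auto.
  - intros n N IH a E. assert (E' := E). apply equipotentP in E as (F & F1 & F2 & F3 & F4).
    destruct (F4 n) as (x & X & Fx); [apply mem_succ; auto|].
    assert (E : equipotent (del x a) n).
    { apply equipotentP. exists F. split; auto. repeat split.
      - intros y Y. apply mem_del in Y as [Y Y'].
        destruct (proj1 (mem_succ n (F y)) (F2 y Y)) as [L|L]; auto.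
        destruct Y'. apply F3; congruence.
      - intros y y' Y Y'. apply mem_del in Y, Y'. now apply F3.
      - intros m L. destruct (F4 m) as (y & Y & Z); [apply mem_succ; auto|].
        exists y. split; auto. apply mem_del. split; auto. intros ->.
        apply (om_irrefl n N). congruence. }
    rewrite <- (add_del x a X). apply K; auto.
    + apply finiteE; eauto.
    + rewrite mem_del. tauto.
Qed.

Lemma finite_subset A B : finite B -> subset A B -> finite A.
Proof.
  intro H. revert B H A. apply (finite_ind (fun B => forall A, subset A B -> finite A)); [def| |].
  - intros A H. replace A with empty; [apply finite_empty|]. symmetry.
    apply empty_unique. intros x X. exact (not_mem_empty x (H x X)).
  - intros B x _ H _ A K.
    assert (L : finite (del x A)).
    { apply H. intros y Y. apply mem_del in Y as [Y Y'].
      apply K, mem_add in Y. tauto. }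
    apply (finite_add x) in L. destruct (classic (x ∈ A)) as [X|X].
    + now rewrite add_del in L.
    + apply H. intros y Y. assert (Z := K y Y). apply mem_add in Z as [Z| ->]; tauto.
Qed.

Lemma finite_cup A B : finite A -> finite B -> finite (cup A B).
Proof.
  intros H K. revert A H. apply (finite_ind (fun A => finite (cup A B))); [def| |].
  - apply (finite_subset _ B); auto. intros x X. apply mem_cup in X as [X|X]; auto.
    destruct (not_mem_empty x X).
  - intros a x _ H _. apply (finite_subset _ (add x (cup a B))); auto using finite_add.
    intros y Y. rewrite mem_cup, mem_add in Y. rewrite mem_add, mem_cup. tauto.
Qed.

Lemma finite_repl A F : DefF F -> finite A -> finite (repl A F).
Proof.
  intro D. revert A. apply (finite_ind (fun A => finite (repl A F))); [def| |].
  - apply (finite_subset _ empty); auto using finite_empty. intros x X.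
    apply mem_repl in X as (y & Y & _); auto. destruct (not_mem_empty y Y).
  - intros a x _ H _. apply (finite_subset _ (add (F x) (repl a F))); auto using finite_add.
    intros y Y. rewrite mem_repl in Y by auto. rewrite mem_add, mem_repl by auto.
    destruct Y as (z & Z & ->). apply mem_add in Z as [Z| ->]; eauto.
Qed.

Lemma finite_Un A : finite A -> (forall a, a ∈ A -> finite a) -> finite (Un A).
Proof.
  revert A. apply (finite_ind (fun A => (forall a, a ∈ A -> finite a) -> finite (Un A))); [def| |].
  - intros _. apply (finite_subset _ empty); auto using finite_empty. intros x X.
    apply mem_Un in X as (y & Y & _); auto. destruct (not_mem_empty y Y).
  - intros a x _ H _ K. apply (finite_subset _ (cup (Un a) x)).
    + apply finite_cup; [apply H|]; intros; apply K; apply mem_add; auto.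
    + intros y Y. rewrite mem_Un in Y. rewrite mem_cup, mem_Un.
      destruct Y as (z & Z & Y). apply mem_add in Z as [Z| ->]; eauto.
Qed.

Lemma finite_pow A : finite A -> finite (pow A).
Proof.
  revert A. apply (finite_ind (fun A => finite (pow A))); [def| |].
  - apply (finite_subset _ (add empty empty)); auto using finite_add, finite_empty.
    intros x X. apply mem_add. right. apply mem_pow in X. apply empty_unique.
    intros y Y. exact (not_mem_empty y (X y Y)).
  - intros a x _ H _.
    apply (finite_subset _ (cup (pow a) (repl (pow a) (fun b => add x b)))).
    + apply finite_cup; auto. apply finite_repl; [def|auto].
    + intros y Y. apply mem_pow in Y. rewrite mem_cup, mem_repl, 1!mem_pow by def.
      assert (K : subset (del x y) a).
      { intros z Z. apply mem_del in Z as [Z Z']. apply Y, mem_add in Z. tauto. }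
      destruct (classic (x ∈ y)) as [X|X].
      * right. exists (del x y). split; [now apply mem_pow|]. now rewrite add_del.
      * left. intros z Z. apply K, mem_del. split; auto. congruence.
Qed.

Lemma finite_injects A B : injects A B -> finite B -> finite A.
Proof.
  intros H K. apply injectsP in H as (F & F1 & F2 & F3).
  apply (finite_equipotent A (repl A F)).
  - apply equipotentP. exists F. repeat split; auto.
    + intros a L. apply mem_repl; eauto.
    + intros b L. apply mem_repl in L; auto.
  - apply (finite_subset _ B); auto. intros y Y. apply mem_repl in Y as (x & X & ->); auto.
Qed.

(** A is covered by its fibres, a finite union of finite sets. The contrapositive shows that a
    sequence taking each value finitely often has infinite range. *)
Lemma finite_fibres A F : DefF F -> finite (repl A F) ->
  (forall y, finite (sep A (fun x => F x = y))) -> finite A.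
Proof.
  intros D H K.
  apply (finite_subset _ (Un (repl (repl A F) (fun y => sep A (fun x => F x = y))))).
  - apply finite_Un.
    + apply finite_repl; [def|auto].
    + intros a L. apply mem_repl in L as (y & Y & ->); [auto|def].
  - intros x X. apply mem_Un. exists (sep A (fun z => F z = F x)). split.
    + apply mem_repl; [def|]. exists (F x). split; auto. apply mem_repl; eauto.
    + apply mem_sep; [def|auto].
Qed.

(** * The pigeonhole principle and infinite countable sets *)

Lemma pigeonhole n : n ∈ om -> ~ injects (succ n) n.
Proof.
  revert n. apply (om_ind (fun n => ~ injects (succ n) n)); [def| |].
  - intro H. apply injectsP in H as (F & _ & H & _).
    apply (not_mem_empty (F empty)), H, mem_succ. auto.
  - intros n N H K. apply H. apply injectsP in K as (F & F1 & F2 & F3). apply injectsP.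
    assert (S : forall m, m ∈ succ n -> m ∈ succ (succ n) /\ m <> succ n).
    { intros m L. split; [apply mem_succ; auto|]. intros ->.
      exact (om_irrefl _ (om_succ n N) L). }
    assert (S' : succ n ∈ succ (succ n)) by (apply mem_succ; auto).
    assert (T : forall m, m ∈ succ (succ n) -> F m <> n -> F m ∈ n).
    { intros m L L'. destruct (proj1 (mem_succ n (F m)) (F2 m L)); tauto. }
    (* The argument whose value is n is redirected to the value of the last element [succ n]. This
       keeps injectivity on [succ n] and makes n free, so the values lie in n. *)
    exists (fun m => ite (F m = n) (F (succ n)) (F m)). split; [def|]. split.
    + intros m L. destruct (S m L) as [L1 L2].
      destruct (classic (F m = n)) as [E|E].
      * rewrite ite_true by auto. apply T; auto. intro E'. apply L2, F3; auto. congruence.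
      * rewrite ite_false by auto. auto.
    + intros m m' L L' E. cbv beta in E. destruct (S m L) as [L1 L2], (S m' L') as [L3 L4].
      destruct (classic (F m = n)), (classic (F m' = n));
        rewrite ?(ite_true (F m = n)), ?(ite_true (F m' = n)), ?(ite_false (F m = n)),
          ?(ite_false (F m' = n)) in E by auto.
      * apply F3; congruence.
      * destruct L4. apply F3; auto; congruence.
      * destruct L2. apply F3; auto; congruence.
      * apply F3; auto.
Qed.

Lemma equipotent_nat n m : n ∈ om -> m ∈ om -> equipotent n m -> n = m.
Proof.
  assert (H : forall n m, n ∈ om -> m ∈ n -> ~ injects n m).
  { intros k l K L N. apply (pigeonhole l); [now apply (om_trans k)|].
    apply (injects_trans _ k); auto. apply subset_injects. intros x X.
    apply mem_succ in X as [X| ->]; auto. now apply (om_mem_trans k l). }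
  intros N N' E. destruct (om_total n m N N') as [L|[L|L]]; auto.
  - destruct (H n m); auto using equipotent_injects.
  - destruct (H m n); auto using equipotent_injects, equipotent_sym.
Qed.

Lemma infinite_om : infinite om.
Proof.
  intro H. apply finiteE in H as (n & N & E). apply (pigeonhole n N).
  apply (injects_trans _ om); [|now apply equipotent_injects].
  apply subset_injects. intros x X. apply (om_trans (succ n)); auto using om_succ.
Qed.

Lemma finite_countable A : finite A -> countable A.
Proof.
  intro H. apply finiteE in H as (n & N & E). apply countableE.
  apply (injects_trans _ n); [now apply equipotent_injects|].
  apply subset_injects. intros x. now apply om_trans.
Qed.

Lemma Dedekind_infinite_infinite A : Dedekind_infinite A -> infinite A.
Proof.
  intros H K. apply Dedekind_infiniteE in H. apply infinite_om.
  now apply (finite_injects _ A).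
Qed.

(* The n-th element of [S] is its unique element with exactly n predecessors in
   [S]; this avoids definitions by recursion on ω. *)
Lemma infinite_subset_om S : subset S om -> infinite S -> injects om S.
Proof.
  intros H K.
  set (P n s := s ∈ S /\ equipotent (sep S (fun t => t ∈ s)) n).
  assert (DP : forall n, Def1 (P n)) by (intro; unfold P; def).
  assert (Ex : forall n, n ∈ om -> exists s, s ∈ om /\ P n s).
  { apply (om_ind (fun n => exists s, s ∈ om /\ P n s)); [unfold P; def| |].
    - destruct (om_least (fun s => s ∈ S)) as (s & N & L & L'); [def| |].
      + apply NNPP. intro L. apply K. apply (finite_subset _ empty finite_empty).
        intros x X. destruct L. exists x. auto.
      + exists s. split; auto. split; auto.
        replace (sep S (fun t => t ∈ s)) with empty; [apply equipotent_refl|].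
        symmetry. apply empty_unique. intros x X. apply mem_sep in X; [|def].
        now apply (L' x).
    - intros n N (s & _ & L & E).
      destruct (om_least (fun t => t ∈ S /\ s ∈ t)) as (t & T & [L1 L2] & L'); [def| |].
      + apply NNPP. intro Q. apply K. apply (finite_subset _ (succ s)).
        * auto using finite_nat, om_succ.
        * intros x X. apply mem_succ. destruct (om_total s x) as [R|[R|R]]; auto.
          destruct Q. exists x. auto.
      + exists t. split; auto. split; auto.
        replace (sep S (fun u => u ∈ t)) with (add s (sep S (fun u => u ∈ s))).
        { apply (equipotent_add _ n s n); auto using om_irrefl.
          rewrite mem_sep by def. intros [_ Q]. now apply (om_irrefl s); auto. }
        apply ext. intro x. rewrite mem_add, 2!mem_sep by def. split.
        * intros [[X X']| ->]; auto. split; auto. now apply (om_mem_trans t s).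
        * intros [X X']. destruct (om_total s x) as [R|[R|R]]; auto.
          destruct (L' x X'). auto. }
  apply injectsP. exists (fun n => mu (P n)). split; [unfold mu, P; def|].
  assert (Sp : forall n, n ∈ om -> P n (mu (P n))).
  { intros n N. now apply mu_spec; auto. }
  split.
  - intros n N. now apply Sp.
  - intros n m N N' E. destruct (Sp n N) as [_ Q], (Sp m N') as [_ Q'].
    rewrite E in Q. apply equipotent_nat; auto.
    apply (equipotent_trans _ (sep S (fun t => t ∈ mu (P m)))); auto.
    now apply equipotent_sym.
Qed.

(** A copy of [A] inside ω can be enumerated in increasing order, so no choice is involved. *)
Lemma countable_infinite A : countable A -> infinite A -> Dedekind_infinite A.
Proof.
  intros H K. apply countableE, injectsP in H as (F & F1 & F2 & F3).
  assert (E : equipotent A (repl A F)).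
  { apply equipotentP. exists F. repeat split; auto.
    - intros a L. apply mem_repl; eauto.
    - intros b L. apply mem_repl in L; auto. }
  apply Dedekind_infiniteE. apply (injects_trans _ (repl A F)).
  - apply infinite_subset_om.
    + intros y Y. apply mem_repl in Y as (x & X & ->); auto.
    + intro L. apply K. now apply (finite_equipotent _ (repl A F)).
  - now apply equipotent_injects, equipotent_sym.
Qed.

(** Each value is coded by the least code of one of its preimages, which avoids choosing
    preimages. *)
Lemma countable_repl A F : DefF F -> countable A -> countable (repl A F).
Proof.
  intros D H. apply countableE, injectsP in H as (h & h1 & h2 & h3).
  set (P y n := exists a, a ∈ A /\ F a = y /\ h a = n).
  assert (Sp : forall y, y ∈ repl A F -> mu (P y) ∈ om /\ P y (mu (P y))).
  { intros y Y. apply mem_repl in Y as (a & L & ->); auto.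
    destruct (mu_spec (P (F a))) as (N & N' & _); auto.
    - unfold P; def.
    - exists (h a). split; auto. now exists a. }
  apply countableE, injectsP. exists (fun y => mu (P y)).
  split; [unfold mu, P; def|]. split.
  - intros y Y. now apply Sp.
  - intros y z Y Z E. destruct (Sp y Y) as (_ & a & A1 & A2 & A3).
    destruct (Sp z Z) as (_ & b & B1 & B2 & B3).
    rewrite <- A2, <- B2. f_equal. apply h3; congruence.
Qed.

(** * Choice and quasi Dedekind-finiteness *)

(** The sequence may repeat values, so its range need not be denumerable. Tagging the elements of
    [F n] with n makes the terms distinct, and the tag is dropped after choosing. *)
Lemma CAC_fin_sequence (F : M -> M) : CAC_fin M -> DefF F ->
  (forall n, n ∈ om -> ~ is_empty (F n) /\ finite (F n)) ->
  exists c : M -> M, DefF c /\ forall n, n ∈ om -> c n ∈ F n.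
Proof.
  intros AC D H.
  set (T n := repl (F n) (fun y => opair n y)).
  assert (DT : DefF T) by (unfold T; def).
  assert (memT : forall n x, x ∈ T n <-> exists y, y ∈ F n /\ x = opair n y)
    by (intros n x; unfold T; rewrite mem_repl by def; reflexivity).
  destruct (AC (repl om T)) as (f & U & _ & Hf & Ch).
  - apply denumerableE, equipotent_sym, equipotentP. exists T. repeat split; auto.
    + intros n N. apply mem_repl; eauto.
    + intros n m N N' E. destruct (nonempty_mem (F n)) as [y Y]; [now apply H|].
      assert (K : opair n y ∈ T m) by (rewrite <- E; apply memT; eauto).
      apply memT in K as (z & _ & K). now apply opair_inj in K.
    + intros b L. apply mem_repl in L; auto.
  - intros a L. apply mem_repl in L as (n & N & ->); auto. split.
    + intro K. destruct (nonempty_mem (F n)) as [y Y]; [now apply H|].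
      apply (K (opair n y)), memT. eauto.
    + unfold T. apply finite_repl; [def|]. now apply H.
  - exists (fun n => second (app f (T n))). split; [def|].
    intros n N. assert (L : T n ∈ repl om T) by (apply mem_repl; eauto).
    assert (K : app f (T n) ∈ T n).
    { apply Ch; auto. apply (is_function_app f _ _ Hf). auto. }
    apply memT in K as (y & Y & ->). now rewrite second_opair.
Qed.

Lemma quasi_Dedekind_finite_Dedekind_finite X :
  quasi_Dedekind_finite X -> Dedekind_finite X.
Proof.
  intros (E & HE & H) K. apply H. apply Dedekind_infiniteE in K.
  apply Dedekind_infiniteE. apply (injects_trans _ X); auto.
  apply injectsP. exists (fun x => upair x x). split; [def|]. split.
  - intros x L. apply HE. split.
    + intros y Y. apply mem_upair in Y as [-> | ->]; auto.
    + apply (finite_subset _ (add x empty)); auto using finite_add, finite_empty.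
      intros y Y. apply mem_upair in Y. apply mem_add. tauto.
  - intros x y _ _ E'. destruct (upair_inj _ _ _ _ E') as [[? _]|[? _]]; auto.
Qed.

Lemma CAC_fin_quasi_Dedekind_finite X :
  CAC_fin M -> Dedekind_finite X -> quasi_Dedekind_finite X.
Proof.
  intros AC HX.
  assert (HE : is_finite_subsets (sep (pow X) finite) X).
  { intro x. rewrite mem_sep, mem_pow by def. reflexivity. }
  exists (sep (pow X) finite). split; auto. intro K.
  apply HX. apply Dedekind_infiniteE, injectsP in K as (g & Dg & g1 & g2).
  assert (gX : forall n, n ∈ om -> subset (g n) X /\ finite (g n))
    by (intros n N; apply HE; auto).
  (* [W n] is the union of the first n sets of the sequence g. *)
  set (W n := Un (repl n g)).
  assert (WE : forall n x, x ∈ W n <-> exists k, k ∈ n /\ x ∈ g k).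
  { intros n x. unfold W. rewrite mem_Un. split.
    - intros (a & L & L'). apply mem_repl in L as (k & N & ->); eauto.
    - intros (k & N & L). exists (g k). rewrite mem_repl by auto. eauto. }
  set (s n := mu (fun m => ~ subset (g m) (W n))).
  assert (Hs : forall n, n ∈ om -> s n ∈ om /\ ~ subset (g (s n)) (W n)).
  { intros n N. destruct (mu_spec (fun m => ~ subset (g m) (W n))) as (L & L' & _); auto.
    - unfold W. def.
    (* If every [g m] were contained in the finite set [W n], then g would inject ω into the finite
       power set of [W n]. *)
    - apply NNPP. intro L.
      assert (Fin : finite (W n)).
      { apply finite_Un; [apply finite_repl; auto using finite_nat|].
        intros a L'. apply mem_repl in L' as (k & N' & ->); auto.
        apply gX. now apply (om_trans n). }
      apply infinite_om, (finite_injects _ (pow (W n))); [|now apply finite_pow].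
      apply injectsP. exists g. split; auto. split; auto.
      intros m N'. apply mem_pow. apply NNPP. intro L'. apply L. eauto. }
  destruct (CAC_fin_sequence (fun n => diff (g (s n)) (W n))) as (c & Dc & Hc); auto.
  { unfold s, mu, W. def. }
  { intros n N. destruct (Hs n N) as [L L']. split.
    - intro Q. apply L'. intros x Xx. apply NNPP. intro X'. apply (Q x).
      apply mem_diff; auto.
    - apply (finite_subset _ (g (s n))); [now apply gX|].
      intros x Xx. now apply mem_diff in Xx. }
  assert (Inf : Dedekind_infinite (repl om c)).
  { apply countable_infinite.
    - apply countable_repl; auto. apply countableE, subset_injects. intros x; auto.
    - intro Fin. apply infinite_om, (finite_fibres om c); auto. intro y.
      (* A value y = c n belongs to [g (s n)], hence to [W m] for every m beyond [s n], while c m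
         avoids [W m]. The fibre of y is therefore contained in [succ (s n)]. *)
      destruct (classic (exists n, n ∈ om /\ c n = y)) as [(n & N & <-)|Q].
      + apply (finite_subset _ (succ (s n))); [apply finite_nat, om_succ, Hs; auto|].
        intros m L. apply mem_sep in L as [L E]; [|def]. apply mem_succ.
        destruct (om_total (s n) m) as [R|[R|R]]; auto; [now apply Hs|].
        assert (C := Hc m L). apply mem_diff in C as [_ C]. destruct C.
        apply WE. exists (s n). split; auto. rewrite E.
        now apply (mem_diff (g (s n)) (W n)), Hc.
      + apply (finite_subset _ empty finite_empty). intros m L.
        apply mem_sep in L as [L E]; [|def]. destruct Q. eauto. }
  apply Dedekind_infiniteE in Inf. apply Dedekind_infiniteE.
  apply (injects_trans _ _ _ Inf), subset_injects.
  intros x Xx. apply mem_repl in Xx as (n & N & ->); auto.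
  apply (gX (s n)); [now apply Hs|]. now apply (mem_diff (g (s n)) (W n)), Hc.
Qed.

(** * The spaces S(X, [X]^{≤ω}) *)

(* The least possible size of a member of [S] is attained only finitely often: a
   set [a] contained in infinitely many members of that size is not in [S], so
   they all meet a finite set disjoint from [a], and [a] extends by a point to a
   larger set of the same kind; but such sets have bounded size. *)
Lemma finite_least_size_members S :
  (forall z, z ∈ S -> finite z) ->
  (forall a z, z ∈ S -> subset a z -> a ∉ S ->
    exists y, finite y /\ disjoint a y /\ forall z', z' ∈ S -> exists u, u ∈ y /\ u ∈ z') ->
  (exists z, z ∈ S) ->
  let T := sep S (fun z => equipotent z (mu (fun k => exists z, z ∈ S /\ equipotent z k))) in
  finite T /\ exists z, z ∈ T.
Proof.
  intros HS Tr [z0 Z0] T.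
  set (k := mu (fun k => exists z, z ∈ S /\ equipotent z k)) in T.
  assert (memT : forall z, z ∈ T <-> z ∈ S /\ equipotent z k)
    by (intro z; unfold T; rewrite mem_sep by def; reflexivity).
  destruct (mu_spec (fun k => exists z, z ∈ S /\ equipotent z k)) as (K & (z1 & Z1 & Z1') & Min).
  { def. }
  { destruct (proj1 (finiteE z0) (HS z0 Z0)) as (n & N & N'). eauto. }
  fold k in K, Z1', Min.
  split; [|exists z1; now apply memT].
  apply NNPP. intro Inf.
  assert (NE : forall a, infinite (sep T (fun z => subset a z)) ->
    exists z, z ∈ T /\ subset a z /\ z <> a).
  { intros a Ia. apply NNPP. intro L. apply Ia.
    apply (finite_subset _ (add a empty)); auto using finite_add, finite_empty.
    intros z Z. apply mem_sep in Z as [Z Z']; [|def]. apply mem_add. right.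
    apply NNPP. intro N. apply L. eauto. }
  assert (Good : forall n, n ∈ om ->
    exists a, equipotent a n /\ infinite (sep T (fun z => subset a z))).
  { apply (om_ind (fun n =>
      exists a, equipotent a n /\ infinite (sep T (fun z => subset a z)))); [def| |].
    - exists empty. split; [apply equipotent_refl|]. intro L. apply Inf.
      apply (finite_subset _ _ L). intros z Z. apply mem_sep; [def|]. split; auto.
      intros x X. destruct (not_mem_empty x X).
    - intros n N (a & A & Ia). destruct (NE a Ia) as (z & Z & Az & Za).
      apply memT in Z as [Z Z'].
      (* A member a of [S] would have at least k elements by minimality, but a is a proper subset of
         z, which has exactly k. *)
      assert (aS : a ∉ S).
      { intro L. assert (exists p, p ∈ z /\ p ∉ a) as (p & P & P').
        { apply NNPP. intro Q. apply Za, ext. intro x. split; auto.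
          intro X. apply NNPP. intro X'. apply Q. eauto. }
        apply (pigeonhole k K), (injects_trans _ z); [|now apply equipotent_injects].
        apply (injects_trans _ (add p a)).
        - apply (injects_trans _ (succ n)).
          + apply subset_injects. intros x X. apply mem_succ. apply mem_succ in X.
            destruct (om_total k n K N) as [R|[R|R]].
            * destruct (Min n R). eauto.
            * now subst.
            * left. destruct X as [X| ->]; auto. now apply (om_mem_trans n k).
          + apply equipotent_injects, equipotent_sym.
            exact (equipotent_add a n p n P' (om_irrefl n N) A).
        - apply subset_injects. intros x X. apply mem_add in X as [X| ->]; auto. }
      destruct (Tr a z Z Az aS) as (y & Fy & Dy & Y).
      assert (exists b, b ∈ y /\ infinite (sep T (fun z => subset (add b a) z)))
        as (b & B & B').
      { apply NNPP. intro L. apply Ia.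
        apply (finite_subset _ (Un (repl y (fun b => sep T (fun z => subset (add b a) z))))).
        - apply finite_Un; [apply finite_repl; [def|auto]|].
          intros c C. apply mem_repl in C as (b & B & ->); [|def].
          apply NNPP. intro Q. apply L. eauto.
        - intros t Ht. apply mem_sep in Ht as [Ht Ht']; [|def]. apply mem_Un.
          destruct (Y t) as (b & B & B'); [now apply memT|].
          exists (sep T (fun z => subset (add b a) z)). split.
          + apply mem_repl; [def|]. eauto.
          + apply mem_sep; [def|]. split; auto. intros x X.
            apply mem_add in X as [X| ->]; auto. }
      exists (add b a). split; auto.
      refine (equipotent_add a n b n _ (om_irrefl n N) A). intro L. now apply (Dy b). }
  destruct (Good (succ k) (om_succ k K)) as (a & A & Ia).
  destruct (NE a Ia) as (z & Z & Az & _). apply memT in Z as [_ Z].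
  apply (pigeonhole k K). apply (injects_trans _ a).
  - now apply equipotent_injects, equipotent_sym.
  - apply (injects_trans _ z); [now apply subset_injects | now apply equipotent_injects].
Qed.

(** * The topology and the P-space condition on canonical sets *)

Definition FinSub X : M := sep (pow X) finite.
Definition CtblSub X : M := sep (pow X) countable.

(** The finite sets between x and the complement of z form the basic neighbourhood of x determined
    by z. [S_open] is then the membership condition that [is_S_space] imposes on the topology. *)
Definition cylinder_in X x z V : Prop := forall y, y ∈ FinSub X -> subset x y ->
  (forall u, u ∈ y -> u ∈ X /\ u ∉ z) -> y ∈ V.

Definition S_open X V : Prop := subset V (FinSub X) /\
  forall x, x ∈ V -> exists z, z ∈ CtblSub X /\ disjoint x z /\ cylinder_in X x z V.

Lemma mem_FinSub X x : x ∈ FinSub X <-> subset x X /\ finite x.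
Proof. unfold FinSub. rewrite mem_sep, mem_pow by def. reflexivity. Qed.

Lemma mem_CtblSub X x : x ∈ CtblSub X <-> subset x X /\ countable x.
Proof. unfold CtblSub. rewrite mem_sep, mem_pow by def. reflexivity. Qed.

(** The union of two witnesses is a witness for an intersection of two open sets, so the first
    hypothesis gives closure under binary intersection. The other axioms of a topology are checked
    for every X. *)
Lemma S_countable_is_P_space_intro X :
  (forall z z', z ∈ CtblSub X -> z' ∈ CtblSub X -> cup z z' ∈ CtblSub X) ->
  (forall C G, countable C -> (forall V, V ∈ C -> S_open X V) ->
    (forall x, x ∈ G <-> x ∈ FinSub X /\ forall V, V ∈ C -> x ∈ V) -> S_open X G) ->
  S_countable_is_P_space X.
Proof.
  intros HU HG.
  set (T := sep (pow (FinSub X)) (S_open X)).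
  assert (HT : forall V, V ∈ T <-> S_open X V).
  { intro V. unfold T. rewrite mem_sep, mem_pow.
    - split; [tauto|]. intro H. split; auto. apply H.
    - unfold S_open, cylinder_in, FinSub, CtblSub. def. }
  exists (CtblSub X), (FinSub X), T. split; [exact (mem_CtblSub X)|].
  split; [split; [exact (mem_FinSub X)|exact HT]|]. split.
  - split; [|split; [|split]].
    + intros V H. apply HT in H. apply H.
    + apply HT. split; [intros x H; exact H|]. intros x H. exists empty. split; [|split].
      * apply mem_CtblSub. split; [|apply finite_countable, finite_empty].
        intros y Y. destruct (not_mem_empty y Y).
      * intros y _. apply not_mem_empty.
      * intros y Y _ _. exact Y.
    + intros U V W H K L. apply HT in H as [H H'], K as [K K']. apply HT. split.
      * intros x Xx. apply H. now apply L in Xx.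
      * intros x Xx. apply L in Xx as [Xu Xv].
        destruct (H' x Xu) as (z & Z1 & Z2 & Z3), (K' x Xv) as (z' & Z1' & Z2' & Z3').
        exists (cup z z'). split; [auto|]. split.
        -- intros u P Q. apply mem_cup in Q as [Q|Q]; [apply (Z2 u)|apply (Z2' u)]; auto.
        -- intros y Y1 Y2 Y3. apply L.
           split; [apply Z3|apply Z3']; auto; intros u Hu; destruct (Y3 u Hu) as [Q R];
             split; auto; intro Q'; apply R, mem_cup; auto.
    + intros C U H K. apply HT. split.
      * intros x L. apply K in L as (V & P & Q). apply H, HT in P. now apply P.
      * intros x L. apply K in L as (V & P & Q). assert (P' := H V P).
        apply HT in P'. destruct (proj2 P' x Q) as (z & Z1 & Z2 & Z3).
        exists z. split; auto. split; auto. intros y Y1 Y2 Y3. apply K. exists V. auto.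
  - intros G (C & HC & K & L). apply HT. apply (HG C); auto.
    intros V P. now apply HT, K.
Qed.

(** Extensionality identifies the sets given by the hypothesis with [FinSub X] and [CtblSub X], so
    the P-space property can be used through [S_open]. *)
Lemma S_countable_is_P_space_Gdelta X C G : S_countable_is_P_space X -> countable C ->
  (forall V, V ∈ C -> S_open X V) ->
  (forall x, x ∈ G <-> x ∈ FinSub X /\ forall V, V ∈ C -> x ∈ V) -> S_open X G.
Proof.
  intros (I & E & T & HI & [HE HT] & _ & HP) HC K L.
  assert (E = FinSub X) as -> by (apply ext; intro x; now rewrite mem_FinSub, (HE x)).
  assert (I = CtblSub X) as -> by (apply ext; intro x; now rewrite mem_CtblSub, (HI x)).
  apply HT, HP. exists C. split; auto. split; auto.
  intros V P. apply HT. now apply K.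
Qed.

Lemma countable_subset A B : countable B -> subset A B -> countable A.
Proof.
  rewrite 2!countableE. intros H K. apply (injects_trans _ B); auto using subset_injects.
Qed.

Lemma countable_P_space X : countable X -> S_countable_is_P_space X.
Proof.
  intro H. apply S_countable_is_P_space_intro.
  - intros z z' Z Z'. apply mem_CtblSub in Z as [Z _], Z' as [Z' _].
    assert (subset (cup z z') X) by (intros x Xx; apply mem_cup in Xx as [Xx|Xx]; auto).
    apply mem_CtblSub. split; auto. now apply (countable_subset _ X).
  - intros C G _ _ HG. split; [intros x L; now apply HG in L|].
    intros x L. exists (diff X x). split; [|split].
    + apply mem_CtblSub. assert (subset (diff X x) X)
        by (intros u U; now apply mem_diff in U).
      split; auto. now apply (countable_subset _ X).
    + intros u U U'. now apply mem_diff in U'.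
    + intros y Y1 Y2 Y3. replace y with x; auto. apply ext. intro u. split; auto.
      intro U. destruct (Y3 u U) as [P Q]. apply NNPP. intro R. apply Q, mem_diff; auto.
Qed.

Lemma quasi_Dedekind_finite_P_space X :
  quasi_Dedekind_finite X -> S_countable_is_P_space X.
Proof.
  intro HX. assert (DF := quasi_Dedekind_finite_Dedekind_finite X HX).
  (* An infinite countable subset would make X Dedekind-infinite, so the countable subsets of X are
     exactly the finite ones. *)
  assert (CF : forall z, z ∈ CtblSub X <-> z ∈ FinSub X).
  { intro z. rewrite mem_CtblSub, mem_FinSub. split; intros [Z Z']; split; auto.
    - apply NNPP. intro N. apply DF. assert (N' := countable_infinite z Z' N).
      apply Dedekind_infiniteE in N'. apply Dedekind_infiniteE.
      apply (injects_trans _ z); auto using subset_injects.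
    - now apply finite_countable. }
  apply S_countable_is_P_space_intro.
  - intros z z' Z Z'. apply CF, mem_FinSub in Z as [Z1 Z2], Z' as [Z1' Z2'].
    apply CF, mem_FinSub. split; auto using finite_cup.
    intros x Xx; apply mem_cup in Xx as [Xx|Xx]; auto.
  - intros C G HC HO HG. split; [intros x L; now apply HG in L|]. intros x Xx.
    set (S V := sep (FinSub X) (fun z => disjoint x z /\ cylinder_in X x z V)).
    (* [S V] is the set of witnesses for x in V. The union of those of least size is picked out
       definably, which replaces choosing a witness for each V. *)
    set (zV V := Un (sep (S V) (fun z =>
      equipotent z (mu (fun k => exists z, z ∈ S V /\ equipotent z k))))).
    assert (DS : forall V, Def1 (fun z => disjoint x z /\ cylinder_in X x z V))
      by (intro V; unfold cylinder_in, FinSub; def).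
    assert (DzV : DefF zV) by (unfold zV, mu, S, cylinder_in, FinSub; def).
    assert (SE : forall V z, z ∈ S V <->
      z ∈ FinSub X /\ disjoint x z /\ cylinder_in X x z V)
      by (intros V z; unfold S; now rewrite mem_sep by auto).
    assert (HzV : forall V, V ∈ C ->
      zV V ∈ FinSub X /\ disjoint x (zV V) /\ cylinder_in X x (zV V) V).
    { intros V HV. apply HG in Xx as [Xx XV].
      destruct (finite_least_size_members (S V)) as [P [z Z]].
      - intros z Z. apply SE in Z as [Z _]. now apply mem_FinSub in Z.
      - intros a z Z Az aS. apply SE in Z as (Z1 & Z2 & Z3). apply mem_FinSub in Z1 as [Z1 Z1'].
        (* If a fails to be a witness, some y above x and disjoint from a lies outside V. Such a y
           meets every witness, since a witness disjoint from it would put y into V. *)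
        assert (Q : exists y, y ∈ FinSub X /\ subset x y /\ disjoint a y /\ y ∉ V).
        { apply NNPP. intro Q. apply aS, SE. split; [|split].
          - apply mem_FinSub. split; [intros u U; auto|]. now apply (finite_subset _ z).
          - intros u U U'. apply (Z2 u); auto.
          - intros y Y1 Y2 Y3. apply NNPP. intro Y4. apply Q. exists y.
            repeat split; auto. intros u U U'. now apply (Y3 u). }
        destruct Q as (y & Y1 & Y2 & Y3 & Y4). exists y.
        split; [now apply mem_FinSub in Y1|]. split; auto.
        intros z' Z'. apply SE in Z' as (_ & _ & Z'). apply NNPP. intro Q.
        apply Y4, Z'; auto. intros u U. split.
        + apply mem_FinSub in Y1 as [Y1 _]. auto.
        + intro U'. apply Q. eauto.
      - destruct (proj2 (HO V HV) x (XV V HV)) as (z & Z). exists z. apply SE. now rewrite <- CF.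
      - match type of P with finite ?t => change (zV V) with (Un t); set (Tk := t) in * end.
        assert (TS : forall z, z ∈ Tk -> z ∈ S V)
          by (intros t Ht; unfold Tk in Ht; now rewrite mem_sep in Ht by def).
        split; [|split].
        + apply mem_FinSub. split.
          * intros u U. apply mem_Un in U as (t & Ht & U).
            apply TS, SE in Ht as [Ht _]. apply mem_FinSub in Ht. now apply Ht.
          * apply finite_Un; auto. intros t Ht. apply TS, SE in Ht as [Ht _].
            now apply mem_FinSub in Ht.
        + intros u U U'. apply mem_Un in U' as (t & Ht & U').
          apply TS, SE in Ht as (_ & Ht & _). now apply (Ht u).
        (* Excluding more points shrinks the cylinder, so it is enough that the union contains one
           witness z. *)
        + intros y Y1 Y2 Y3. assert (Z' := TS z Z). apply SE in Z' as (_ & _ & Z').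
          apply Z'; auto. intros u U. destruct (Y3 u U) as [Q R]. split; auto.
          intro U'. apply R, mem_Un. eauto. }
    (* The sets [zV V] form a countable subset of the Dedekind-finite set of finite subsets of X,
       hence a finite one. *)
    assert (Fin : finite (repl C zV)).
    { apply NNPP. intro N. destruct HX as (E & HE & HF). apply HF.
      apply (countable_repl C zV DzV) in HC.
      assert (N' := countable_infinite _ HC N). apply Dedekind_infiniteE in N'.
      apply Dedekind_infiniteE. apply (injects_trans _ _ _ N'), subset_injects.
      intros y Y. apply mem_repl in Y as (V & HV & ->); auto.
      apply HE, mem_FinSub. now destruct (HzV V HV). }
    exists (Un (repl C zV)). split; [|split].
    + apply CF, mem_FinSub. split.
      * intros u U. apply mem_Un in U as (z & Z & U). apply mem_repl in Z as (V & HV & ->); auto.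
        destruct (HzV V HV) as [L _]. apply mem_FinSub in L. now apply L.
      * apply finite_Un; auto. intros z Z. apply mem_repl in Z as (V & HV & ->); auto.
        destruct (HzV V HV) as [L _]. apply mem_FinSub in L. now apply L.
    + intros u U U'. apply mem_Un in U' as (z & Z & U'). apply mem_repl in Z as (V & HV & ->); auto.
      now apply (proj1 (proj2 (HzV V HV)) u).
    + intros y Y1 Y2 Y3. apply HG. split; auto. intros V HV.
      apply (HzV V HV); auto. intros u U. destruct (Y3 u U) as [Q R]. split; auto.
      intro U'. apply R, mem_Un. exists (zV V). split; auto. apply mem_repl; eauto.
Qed.

(** * From P-spaces back to choice *)

Section PartialChoice.
Context (A : M) (g : M -> M) (Dg : DefF g) (gom : into g A om) (ginj : inj_on g A)
  (HA : forall a, a ∈ A -> ~ is_empty a /\ finite a).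

Definition initial n : M := sep A (fun a => g a ∈ n).
(** The pairs (a, b) with b in a, for a of code below n. A choice function on this initial segment
    is a subset of them having exactly one pair over each a. *)
Definition initial_pairs n : M :=
  Un (repl (initial n) (fun a => repl a (fun b => opair a b))).
Definition partial_choices n : M := sep (pow (initial_pairs n)) (fun s =>
  forall a, a ∈ initial n ->
    exists b, opair a b ∈ s /\ forall b', opair a b' ∈ s -> b' = b).

Lemma mem_initial n a : a ∈ initial n <-> a ∈ A /\ g a ∈ n.
Proof. unfold initial. rewrite mem_sep by def. reflexivity. Qed.

Lemma mem_initial_pairs n p :
  p ∈ initial_pairs n <-> exists a b, p = opair a b /\ a ∈ A /\ g a ∈ n /\ b ∈ a.
Proof.
  unfold initial_pairs. rewrite mem_Un. split.
  - intros (c & C & P). apply mem_repl in C as (a & K & ->); [|def].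
    apply mem_repl in P as (b & L & ->); [|def]. apply mem_initial in K as [K K'].
    exists a, b. auto.
  - intros (a & b & -> & K & K' & L). exists (repl a (fun b => opair a b)).
    rewrite 2!mem_repl by def. split; [exists a; rewrite mem_initial; auto | eauto].
Qed.

Lemma mem_partial_choices n s : s ∈ partial_choices n <->
  subset s (initial_pairs n) /\ forall a, a ∈ A -> g a ∈ n ->
    exists b, opair a b ∈ s /\ forall b', opair a b' ∈ s -> b' = b.
Proof.
  unfold partial_choices. rewrite mem_sep, mem_pow by (unfold initial; def).
  split; intros [H K]; split; auto; intros a L.
  - intro L'. apply K, mem_initial. auto.
  - apply mem_initial in L as [L L']. auto.
Qed.

Lemma finite_partial_choices n : n ∈ om -> finite (partial_choices n).
Proof.
  intro N. apply (finite_subset _ (pow (initial_pairs n))).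
  - apply finite_pow, finite_Un.
    + apply finite_repl; [def|]. apply (finite_injects _ n); auto using finite_nat.
      apply injectsP. exists g. split; auto. split.
      * intros a K. now apply mem_initial in K.
      * intros a a' K K'. apply mem_initial in K, K'. now apply ginj.
    + intros c C. apply mem_repl in C as (a & K & ->); [|def].
      apply finite_repl; [def|]. apply mem_initial in K as [K _]. now apply HA.
  - intros s Hs. apply mem_partial_choices in Hs as [Hs _]. now apply mem_pow.
Qed.

(** By injectivity of [g] at most one member of [A] has code n, so passing from n to [succ n]
    requires at most one new value. *)
Lemma partial_choice_exists n : n ∈ om -> exists s, s ∈ partial_choices n.
Proof.
  revert n. apply om_ind.
  - unfold partial_choices, initial_pairs, initial. def.
  - exists empty. apply mem_partial_choices. split.
    + intros x X. destruct (not_mem_empty x X).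
    + intros a _ K. destruct (not_mem_empty _ K).
  - intros n N (s & Hs). apply mem_partial_choices in Hs as [H1 H2].
    assert (Sub : forall p, p ∈ s -> p ∈ initial_pairs (succ n)).
    { intros p P. apply H1, mem_initial_pairs in P as (a & b & -> & K & K' & L).
      apply mem_initial_pairs. exists a, b. rewrite mem_succ. auto. }
    destruct (classic (exists a, a ∈ A /\ g a = n)) as [(a & K & G)|Q].
    + destruct (nonempty_mem a) as [b L]; [now apply HA|].
      exists (add (opair a b) s). apply mem_partial_choices. split.
      * intros p P. apply mem_add in P as [P| ->]; auto.
        apply mem_initial_pairs. exists a, b. rewrite mem_succ. auto.
      * intros a' K' G'. apply mem_succ in G' as [G'|G'].
        -- destruct (H2 a' K' G') as (b' & P & U). exists b'. rewrite mem_add. split; auto.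
           intros c C. apply mem_add in C as [C|C]; auto.
           apply opair_inj in C as [-> _]. destruct (om_irrefl n N). congruence.
        -- assert (a' = a) as -> by (apply ginj; congruence).
           exists b. rewrite mem_add. split; auto.
           intros c C. apply mem_add in C as [C|C]; [|now apply opair_inj in C].
           apply H1, mem_initial_pairs in C as (d & e & E & _ & D & _).
           apply opair_inj in E as [-> _]. destruct (om_irrefl n N). congruence.
    + exists s. apply mem_partial_choices. split; auto.
      intros a K G. apply mem_succ in G as [G|G]; auto. destruct Q. eauto.
Qed.

Lemma DefF_partial_choices : DefF partial_choices.
Proof. unfold partial_choices, initial_pairs, initial. def. Qed.

(** The tag keeps levels apart even when no member of [A] has code n, in which case the partial
    choices for n and for [succ n] coincide. *)
Definition level n : M := repl (partial_choices n) (fun s => opair n s).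
Definition all_partial_choices : M := Un (repl om level).

Lemma DefF_level : DefF level.
Proof. assert (D := DefF_partial_choices). unfold level. def. Qed.

Lemma mem_level n p : p ∈ level n <-> exists s, s ∈ partial_choices n /\ p = opair n s.
Proof. unfold level. rewrite mem_repl by def. reflexivity. Qed.

Lemma mem_all_partial_choices p : p ∈ all_partial_choices <->
  exists n, n ∈ om /\ p ∈ level n.
Proof.
  unfold all_partial_choices. rewrite mem_Un. setoid_rewrite (mem_repl _ _ DefF_level).
  split; [intros (x & (n & N & ->) & P) | intros (n & N & P)]; eauto.
Qed.

(** No level is empty, so the tags of the elements exhaust ω. *)
Lemma infinite_all_partial_choices : infinite all_partial_choices.
Proof.
  intro Fin. apply infinite_om.
  set (first p := the (fun a => exists b, p = opair a b)).
  assert (D : DefF first) by (unfold first; def).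
  apply (finite_subset _ (repl all_partial_choices first)); [now apply finite_repl|].
  intros n N. apply mem_repl; auto. destruct (partial_choice_exists n N) as [s Hs].
  exists (opair n s). split.
  - apply mem_all_partial_choices. exists n. rewrite mem_level. eauto.
  - symmetry. apply the_eq; [now exists s|]. intros a [b E]. now apply opair_inj in E.
Qed.

(* The members of [FinSub Y] avoiding a given level form an open set, and only
   the empty set avoids them all. *)
Lemma P_space_countable_choices Y :
  subset Y all_partial_choices -> S_countable_is_P_space Y -> countable Y.
Proof.
  intros HY HP.
  set (V n := sep (FinSub Y) (fun y => disjoint y (level n))).
  assert (DL := DefF_level).
  assert (DV : DefF V) by (unfold V, FinSub; def).
  assert (memV : forall n y, y ∈ V n <-> y ∈ FinSub Y /\ disjoint y (level n))
    by (intros n y; unfold V; rewrite mem_sep by def; reflexivity).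
  assert (O : S_open Y (upair empty empty)).
  { apply (S_countable_is_P_space_Gdelta Y (repl om V)); auto.
    - apply countable_repl; auto. apply countableE, subset_injects. intros x; auto.
    - intros W HW. apply mem_repl in HW as (n & N & ->); auto. split.
      + intros y Hy. now apply memV in Hy.
      + intros x Hx. apply memV in Hx as [_ Hx].
        (* A level is finite, so its trace on Y is a legitimate set to exclude, and every y avoiding
           it is again in [V n]. *)
        exists (sep Y (fun p => p ∈ level n)). split; [|split].
        * apply mem_CtblSub. split.
          -- intros p P. apply mem_sep in P; [tauto|def].
          -- apply finite_countable, (finite_subset _ (level n)).
             ++ apply finite_repl; [def|]. now apply finite_partial_choices.
             ++ intros p P. apply mem_sep in P; [tauto|def].
        * intros u U U'. apply mem_sep in U' as [_ U']; [|def]. now apply (Hx u).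
        * intros y Hy _ K. apply memV. split; auto. intros u U U'.
          destruct (K u U) as [L L']. apply L', mem_sep; [def|auto].
    - intro x. rewrite mem_upair. split.
      + intro E. assert (x = empty) as -> by tauto. split.
        * apply mem_FinSub. split; auto using finite_empty.
          intros y Hy. destruct (not_mem_empty y Hy).
        * intros W HW. apply mem_repl in HW as (n & N & ->); auto. apply memV. split.
          -- apply mem_FinSub. split; auto using finite_empty.
             intros y Hy. destruct (not_mem_empty y Hy).
          -- intros y Hy. destruct (not_mem_empty y Hy).
      + intros [K L]. left. apply empty_unique. intros p P.
        apply mem_FinSub in K as [K _].
        destruct (proj1 (mem_all_partial_choices p) (HY p (K p P))) as (n & N & Q).
        assert (R : x ∈ V n) by (apply L, mem_repl; eauto).
        apply memV in R as [_ R]. now apply (R p). }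
  (* The neighbourhood of ∅ given by a countable z contains only ∅. A point p of Y outside z would
     put the singleton of p into it, so Y is contained in z. *)
  destruct (proj2 O empty) as (z & Z & _ & Cyl); [apply mem_upair; auto|].
  apply mem_CtblSub in Z as [_ Z]. apply (countable_subset _ z); auto.
  intros p P. apply NNPP. intro Q.
  assert (R : add p empty ∈ upair empty empty).
  { apply Cyl.
    - apply mem_FinSub. split; auto using finite_add, finite_empty. intros x Hx.
      apply mem_add in Hx as [Hx| ->]; auto. destruct (not_mem_empty x Hx).
    - intros x Hx. destruct (not_mem_empty x Hx).
    - intros u U. apply mem_add in U as [U| ->]; auto. destruct (not_mem_empty u U). }
  apply (not_mem_empty p). apply mem_upair in R.
  assert (E : add p empty = empty) by tauto. rewrite <- E. apply mem_add. auto.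
Qed.

Lemma choice_of_countable_choices Y : subset Y all_partial_choices -> infinite Y ->
  countable Y -> exists f, is_choice_function f A.
Proof.
  intros HY Inf Ct. apply countableE, injectsP in Ct as (h & Dh & h1 & h2).
  assert (DL := DefF_level).
  (* [Q n p] says that p belongs to Y and is defined at code n. [p n] is the solution with the least
     code under h, unique because h is injective. *)
  set (Q n p := p ∈ Y /\ exists m, n ∈ m /\ p ∈ level m).
  set (k n := mu (fun i => exists p, Q n p /\ h p = i)).
  set (p n := the (fun p => p ∈ Y /\ h p = k n)).
  assert (Hp : forall n, n ∈ om -> Q n (p n)).
  { intros n N. destruct (mu_spec (fun i => exists p, Q n p /\ h p = i))
      as (_ & (q & Hq & E) & _).
    - unfold Q. def.
    (* Otherwise Y would be contained in the levels up to n, a finite union of finite sets. *)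
    - apply NNPP. intro L. apply Inf.
      apply (finite_subset _ (Un (repl (succ n) level))).
      + apply finite_Un.
        * apply finite_repl; auto using finite_nat, om_succ.
        * intros a K. apply mem_repl in K as (m & K & ->); auto.
          apply finite_repl; [def|]. apply finite_partial_choices.
          apply (om_trans (succ n)); auto using om_succ.
      + intros q Hq. apply mem_Un.
        destruct (proj1 (mem_all_partial_choices q) (HY q Hq)) as (m & K & K').
        exists (level m). split; auto. apply mem_repl; auto. exists m. split; auto.
        apply mem_succ. destruct (om_total n m N K) as [R|[R|R]]; auto.
        destruct L. exists (h q). split; auto. exists q. split; auto. split; eauto.
    - change (h q = k n) in E. assert (p n = q) as ->; auto.
      apply the_eq; [split; [apply Hq|auto]|]. intros q' [K K'].
      apply h2; auto; [apply Hq|congruence]. }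
  (* The value at a is read off the partial choice function selected for the code of a, after its
     tag is removed. *)
  set (F a := the (fun b => opair a b ∈ second (p (g a)))).
  assert (HF : forall a, a ∈ A -> F a ∈ a).
  { intros a K. destruct (Hp (g a)) as (_ & m & G & P); auto.
    apply mem_level in P as (s & Hs & E). apply mem_partial_choices in Hs as [H1 H2].
    destruct (H2 a K G) as (b & B & U).
    assert (F a = b) as ->.
    { unfold F. rewrite E, second_opair. now apply the_eq. }
    apply H1, mem_initial_pairs in B as (a' & b' & E' & _ & _ & L).
    apply opair_inj in E' as [-> ->]. exact L. }
  assert (DF : DefF F) by (unfold F, p, k, mu, Q; def).
  exists (lam A F), (Un A). split; [intro; apply mem_Un|]. split.
  - apply lam_function; auto. intros a K. apply mem_Un. eauto.
  - intros a b K L. apply maps_lam in L as [_ ->]; auto.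
Qed.

End PartialChoice.

Lemma PS2_CAC_fin : PS2 M -> CAC_fin M.
Proof.
  intros H A Den HA. apply denumerableE, equipotent_injects, injectsP in Den
    as (g & Dg & g1 & g2).
  destruct (H (all_partial_choices A g)) as (Y & HY & Inf & HP).
  - now apply infinite_all_partial_choices.
  - apply (choice_of_countable_choices A g) with (Y := Y); auto.
    now apply (P_space_countable_choices A g).
Qed.

Lemma Dedekind_infinite_P_subspace X : Dedekind_infinite X ->
  exists Y, subset Y X /\ infinite Y /\ S_countable_is_P_space Y.
Proof.
  intro H. apply Dedekind_infiniteE, injectsP in H as (F & DF & F1 & F2).
  exists (repl om F). split; [|split].
  - intros y Y. apply mem_repl in Y as (n & N & ->); auto.
  - apply Dedekind_infinite_infinite, Dedekind_infiniteE, injectsP. exists F.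
    repeat split; auto. intros n N. apply mem_repl; eauto.
  - apply countable_P_space, countable_repl; auto.
    apply countableE, subset_injects. intros x; auto.
Qed.

End ZFModel.

(** * The cycle of implications between the five principles *)

Theorem theorem7p5 (M : set_structure) (HZF : ZF M) :
  let i := CAC_fin M in
  let ii := forall X : M, Dedekind_finite X <-> quasi_Dedekind_finite X in
  let iii := forall X : M, infinite X ->
               S_countable_is_P_space X \/ Dedekind_infinite X in
  let iv := forall X : M, infinite X -> Dedekind_finite X ->
              S_countable_is_P_space X in
  let v := PS2 M in
  (i <-> ii) /\ (ii <-> iii) /\ (iii <-> iv) /\ (iv <-> v).
Proof.
  intros i ii iii iv v.
  assert (H1 : i -> ii).
  { intros H X. split.
    - now apply CAC_fin_quasi_Dedekind_finite.
    - now apply quasi_Dedekind_finite_Dedekind_finite. }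
  assert (H2 : ii -> iii).
  { intros H X _. destruct (classic (Dedekind_infinite X)) as [K|K]; auto.
    left. apply quasi_Dedekind_finite_P_space; auto. now apply H. }
  assert (H3 : iii -> iv).
  { intros H X K L. destruct (H X K); [auto|contradiction]. }
  assert (H4 : iv -> v).
  { intros H X K. destruct (classic (Dedekind_infinite X)) as [L|L].
    - now apply Dedekind_infinite_P_subspace.
    - exists X. split; [intros x; auto|]. split; auto. }
  assert (H5 : v -> i) by now apply PS2_CAC_fin.
  tauto.
Qed.
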